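(* Assume the map $u\mapsto J^0(0,0;u)$ is convex, and for each $\varepsilon>0$ let $(P^\varepsilon,\Pi^\varepsilon)$ be the strongly regular solution of the $\varepsilon$-GRE with associated gains $\Theta^\varepsilon_k,\bar\Theta^\varepsilon_k$. If $$\sup_{\varepsilon>0}\sum_{k=0}^{N-1}\big(|\Theta_k^\varepsilon|^2+|\bar\Theta_k^\varepsilon|^2\big)<\infty,$$ then the GRE is regularly solvable and Problem (MF-LQ)$^0$ is closed-loop solvable.
   Context: Fix integers $N\ge1$, $n,m\ge1$, $\mathbb N_0=\{0,\dots,N-1\}$. On a complete probability space, for initial time $l\in\mathbb N_0$, let $\omega_l,\dots,\omega_{N-1}$ be real random variables and $\xi$ a square-integrable $\mathbb R^n$-valued initial state independent of them; $\mathfrak F_k=\sigma\{\xi,\omega_l,\dots,\omega_k\}$, $\mathbb E[\omega_{k+1}|\mathfrak F_k]=0$, $\mathbb E[\omega_{k+1}^2|\mathfrak F_k]=1$. $\mathscr U_{ad}$: sequences $u=(u_l,\dots,u_{N-1})$, $u_k$ $\mathfrak F_k$-measurable in $\mathbb R^m$, $\mathbb E\sum|u_k|^2<\infty$. Problem (MF-LQ)$^0$: state $x_{k+1}=A_kx_k+\bar A_k\mathbb Ex_k+B_ku_k+\bar B_k\mathbb Eu_k+(C_kx_k+\bar C_k\mathbb Ex_k+D_ku_k+\bar D_k\mathbb Eu_k)\omega_k$, $x_l=\xi$; cost $J^0(l,\xi;u)=\mathbb E\{\langle Gx_N,x_N\rangle+\langle\bar G\mathbb Ex_N,\mathbb Ex_N\rangle+\sum_{k=l}^{N-1}[\langle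 Q_kx_k,x_k\rangle+2\langle S_ku_k,x_k\rangle+\langle R_ku_k,u_k\rangle+\langle\bar Q_k\mathbb Ex_k,\mathbb Ex_k\rangle+2\langle\bar S_k\mathbb Eu_k,\mathbb Ex_k\rangle+\langle\bar R_k\mathbb Eu_k,\mathbb Eu_k\rangle]\}$, deterministic $A_k,\bar A_k,C_k,\bar C_k,Q_k,\bar Q_k,G,\bar G\in\mathbb R^{n\times n}$, $B_k,\bar B_k,D_k,\bar D_k,S_k,\bar S_k\in\mathbb R^{n\times m}$, $R_k,\bar R_k\in\mathbb R^{m\times m}$, $Q,\bar Q,R,\bar R,G,\bar G$ symmetric. A closed-loop strategy on $\{l,\dots,N-1\}$ is a triple $(\Theta,\bar\Theta,v)$ of deterministic $\Theta_k,\bar\Theta_k\in\mathbb R^{m\times n}$, $v_k\in\mathbb R^m$ independent of $\xi$; it is optimal if for every $\xi$, $J^0(l,\xi;\Theta x^*+\bar\Theta\mathbb Ex^*+v)\le J^0(l,\xi;u)$ for all $u$, $x^*$ being the state generated from $x^*_l=\xi$ by the feedback; closed-loop solvable means such a strategy exists for every $l\in\mathbb N_0$. GRE: $\Upsilon_k=R_k+B_k'P_{k+1}B_k+D_k'P_{k+1}D_k$, $\bar\Upsilon_k=R_k+\bar R_k+(B_k+\bar B_k)'\Pi_{k+1}(B_k+\bar B_k)+(D_k+\bar D_k)'P_{k+1}(D_k+\bar D_k)$, $H_k=B_k'P_{k+1}A_k+D_k'P_{k+1}C_k+S_k'$, $\bar H_k=(B_k+\bar B_k)'\Pi_{k+1}(A_k+\bar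 A_k)+(D_k+\bar D_k)'P_{k+1}(C_k+\bar C_k)+S_k'+\bar S_k'$; $P_k=Q_k+A_k'P_{k+1}A_k+C_k'P_{k+1}C_k-H_k'\Upsilon_k^\dagger H_k$, $\Pi_k=Q_k+\bar Q_k+(A_k+\bar A_k)'\Pi_{k+1}(A_k+\bar A_k)+(C_k+\bar C_k)'P_{k+1}(C_k+\bar C_k)-\bar H_k'\bar\Upsilon_k^\dagger\bar H_k$, $P_N=G$, $\Pi_N=G+\bar G$ ($\dagger$ = Moore–Penrose pseudoinverse); regular: $\Upsilon_k,\bar\Upsilon_k\ge0$, $\mathcal R(H_k)\subseteq\mathcal R(\Upsilon_k)$, $\mathcal R(\bar H_k)\subseteq\mathcal R(\bar\Upsilon_k)$, $\Upsilon_k^\dagger H_k,\bar\Upsilon_k^\dagger\bar H_k$ square-summable. $\varepsilon$-GRE: the same with $R_k$ replaced by $R_k+\varepsilon I$ in $\Upsilon_k$ and $R_k+\bar R_k$ by $R_k+\bar R_k+\varepsilon I$ in $\bar\Upsilon_k$ (denoted $\Upsilon^\varepsilon_k,\bar\Upsilon^\varepsilon_k,H^\varepsilon_k,\bar H^\varepsilon_k$, with inverses in place of pseudoinverses); strongly regular means $\Upsilon^\varepsilon_k,\bar\Upsilon^\varepsilon_k\ge\varepsilon I$; gains $\Theta^\varepsilon_k=-(\Upsilon^\varepsilon_k)^{-1}H^\varepsilon_k$, $\bar\Theta^\varepsilon_k=-(\bar\Upsilon^\varepsilon_k)^{-1}\bar H^\varepsilon_k$.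
   Formalization: The control u_k is measurable for σ{ξ, ω_l,…,ω_{k-1}} rather than σ{ξ, ω_l,…,ω_k}, and the conditions E[ω_k|·]=0, E[ω_k²|·]=1 are shifted to that past (including k=l); if u_k could see ω_k the claim would fail. *)

(* Defs.v *)
From HB Require Import structures.
From mathcomp Require Import all_boot all_order all_algebra.
From mathcomp Require Import all_classical all_reals all_analysis.
Set Implicit Arguments. Unset Strict Implicit. Unset Printing Implicit Defensive.
Import Order.TTheory GRing.Theory Num.Theory.
Local Open Scope classical_set_scope.
Local Open Scope ring_scope.

Record MFLQdata (R : realType) (n m : nat) := MkMFLQ {
  cA : nat -> 'M[R]_n;  cAb : nat -> 'M[R]_n;
  cC : nat -> 'M[R]_n;  cCb : nat -> 'M[R]_n;
  cB : nat -> 'M[R]_(n, m); cBb : nat -> 'M[R]_(n, m);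
  cD : nat -> 'M[R]_(n, m); cDb : nat -> 'M[R]_(n, m);
  cQ : nat -> 'M[R]_n;  cQb : nat -> 'M[R]_n;
  cS : nat -> 'M[R]_(n, m); cSb : nat -> 'M[R]_(n, m);
  cR : nat -> 'M[R]_m;  cRb : nat -> 'M[R]_m;
  cG : 'M[R]_n; cGb : 'M[R]_n }.

Definition MFLQ_symmetric R n m (D : MFLQdata R n m) : Prop :=
  (forall k, (cQ D k)^T = cQ D k) /\ (forall k, (cQb D k)^T = cQb D k) /\
  (forall k, (cR D k)^T = cR D k) /\ (forall k, (cRb D k)^T = cRb D k) /\
  (cG D)^T = cG D /\ (cGb D)^T = cGb D.

Definition quad (R : realType) p (M : 'M[R]_p) (x : 'cV[R]_p) : R :=
  (x^T *m M *m x) 0 0.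
Definition bil (R : realType) p q (M : 'M[R]_(p, q)) (u : 'cV[R]_q)
  (x : 'cV[R]_p) : R := (x^T *m (M *m u)) 0 0.

Definition mx_geI (R : realType) p (M : 'M[R]_p) (c : R) : Prop :=
  forall v : 'cV[R]_p, c * (v^T *m v) 0 0 <= quad M v.

Definition is_MP_inverse (R : realType) p (M X : 'M[R]_p) : Prop :=
  [/\ M *m X *m M = M, X *m M *m X = X,
      (M *m X)^T = M *m X & (X *m M)^T = X *m M].

Definition frob2 (R : realType) p q (M : 'M[R]_(p, q)) : R :=
  \sum_(i < p) \sum_(j < q) M i j ^+ 2.

(* Riccati quantities.  eps = 0 gives the GRE, eps > 0 the eps-GRE.     *)
(* P1, Pi1 stand for P_{k+1}, Pi_{k+1}.                                  *)
Section Riccati.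
Context {R : realType} {n m : nat} (D : MFLQdata R n m).

Definition Ups (eps : R) (P1 : 'M[R]_n) (k : nat) : 'M[R]_m :=
  cR D k + eps%:M + (cB D k)^T *m P1 *m cB D k + (cD D k)^T *m P1 *m cD D k.

Definition Upsb (eps : R) (P1 Pi1 : 'M[R]_n) (k : nat) : 'M[R]_m :=
  cR D k + cRb D k + eps%:M
  + (cB D k + cBb D k)^T *m Pi1 *m (cB D k + cBb D k)
  + (cD D k + cDb D k)^T *m P1 *m (cD D k + cDb D k).

Definition Hm (P1 : 'M[R]_n) (k : nat) : 'M[R]_(m, n) :=
  (cB D k)^T *m P1 *m cA D k + (cD D k)^T *m P1 *m cC D k + (cS D k)^T.

Definition Hmb (P1 Pi1 : 'M[R]_n) (k : nat) : 'M[R]_(m, n) :=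
  (cB D k + cBb D k)^T *m Pi1 *m (cA D k + cAb D k)
  + (cD D k + cDb D k)^T *m P1 *m (cC D k + cCb D k)
  + (cS D k)^T + (cSb D k)^T.

(* right-hand sides of the Riccati recursions, with a generic
   "inverse" X of Ups and Xb of Upsb *)
Definition Pstep (P1 : 'M[R]_n) (X : 'M[R]_m) (k : nat) : 'M[R]_n :=
  cQ D k + (cA D k)^T *m P1 *m cA D k + (cC D k)^T *m P1 *m cC D k
  - (Hm P1 k)^T *m X *m Hm P1 k.

Definition Pistep (P1 Pi1 : 'M[R]_n) (Xb : 'M[R]_m) (k : nat) : 'M[R]_n :=
  cQ D k + cQb D k
  + (cA D k + cAb D k)^T *m Pi1 *m (cA D k + cAb D k)
  + (cC D k + cCb D k)^T *m P1 *m (cC D k + cCb D k)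
  - (Hmb P1 Pi1 k)^T *m Xb *m Hmb P1 Pi1 k.

Definition GRE_regular_solution (N : nat) (P Pi : nat -> 'M[R]_n) : Prop :=
  P N = cG D /\ Pi N = cG D + cGb D /\
  forall k, (k < N)%N ->
    exists X Xb : 'M[R]_m,
      is_MP_inverse (Ups 0 (P k.+1) k) X /\
      is_MP_inverse (Upsb 0 (P k.+1) (Pi k.+1) k) Xb /\
      P k = Pstep (P k.+1) X k /\
      Pi k = Pistep (P k.+1) (Pi k.+1) Xb k /\
      mx_geI (Ups 0 (P k.+1) k) 0 /\
      mx_geI (Upsb 0 (P k.+1) (Pi k.+1) k) 0 /\
      ((Hm (P k.+1) k)^T <= (Ups 0 (P k.+1) k)^T)%MS /\
      ((Hmb (P k.+1) (Pi k.+1) k)^T <= (Upsb 0 (P k.+1) (Pi k.+1) k)^T)%MS.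

Definition GRE_regularly_solvable (N : nat) : Prop :=
  exists P Pi : nat -> 'M[R]_n, GRE_regular_solution N P Pi.

Definition epsGRE_strongly_regular_solution (N : nat) (eps : R)
  (P Pi : nat -> 'M[R]_n) : Prop :=
  P N = cG D /\ Pi N = cG D + cGb D /\
  forall k, (k < N)%N ->
    [/\ P k = Pstep (P k.+1) (invmx (Ups eps (P k.+1) k)) k,
        Pi k = Pistep (P k.+1) (Pi k.+1) (invmx (Upsb eps (P k.+1) (Pi k.+1) k)) k,
        mx_geI (Ups eps (P k.+1) k) eps &
        mx_geI (Upsb eps (P k.+1) (Pi k.+1) k) eps].

Definition Theta_eps (eps : R) (P : nat -> 'M[R]_n) (k : nat) : 'M[R]_(m, n) :=
  - (invmx (Ups eps (P k.+1) k) *m Hm (P k.+1) k).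

Definition Thetab_eps (eps : R) (P Pi : nat -> 'M[R]_n) (k : nat) : 'M[R]_(m, n) :=
  - (invmx (Upsb eps (P k.+1) (Pi k.+1) k) *m Hmb (P k.+1) (Pi k.+1) k).

End Riccati.

Section Stoch.
Context {d : measure_display} {T : measurableType d} {R : realType}
  (P : probability T R).

Definition Ex (f : T -> R) : R := (\int[P]_(t in setT) f t)%R.

Definition Evec p (X : T -> 'cV[R]_p) : 'cV[R]_p :=
  \col_i Ex (fun t => X t i 0).

Definition sq_integrable (f : T -> R) : Prop :=
  measurable_fun setT f /\ P.-integrable setT (fun t => ((f t) ^+ 2)%:E).

Definition vec_sq_integrable p (X : T -> 'cV[R]_p) : Prop :=
  forall i, sq_integrable (fun t => X t i 0).

Definition sigma_gen (fs : set (T -> R)) : set (set T) :=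
  <<s [set A | exists f, fs f /\ exists2 B : set R, measurable B & A = f @^-1` B] >>.

Definition meas_wrt (F : set (set T)) (f : T -> R) : Prop :=
  forall B : set R, measurable B -> F (f @^-1` B).

Definition indep_sigma (F1 F2 : set (set T)) : Prop :=
  forall A B, F1 A -> F2 B -> P (A `&` B) = (P A * P B)%E.

Variables (N n m : nat) (D : MFLQdata R n m) (w : nat -> T -> R).

Definition info (l : nat) (xi : T -> 'cV[R]_n) (k : nat) : set (set T) :=
  sigma_gen [set f | (exists i, f = fun t => xi t i 0) \/
                     (exists j, (l <= j < k)%N /\ f = w j)].

(* standing assumptions on the noise: E[w_k | F] = 0, E[w_k^2 | F] = 1,
   F = sigma{w_0,...,w_(k-1)}, written via the defining property of
   conditional expectation *)
Definition noise_assumptions : Prop :=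
  forall k, (k < N)%N ->
    let F := sigma_gen [set f | exists j, (j < k)%N /\ f = w j] in
    [/\ P.-integrable setT (fun t => (w k t)%:E),
        P.-integrable setT (fun t => ((w k t) ^+ 2)%:E),
        (forall A, F A -> (\int[P]_(t in A) (w k t)%:E = 0)%E) &
        (forall A, F A -> (\int[P]_(t in A) ((w k t) ^+ 2)%:E = P A)%E)].

Definition adm_init (l : nat) (xi : T -> 'cV[R]_n) : Prop :=
  vec_sq_integrable xi /\
  indep_sigma (sigma_gen [set f | exists i, f = fun t => xi t i 0])
              (sigma_gen [set f | exists j, (l <= j < N)%N /\ f = w j]).

Definition adm_ctrl (l : nat) (xi : T -> 'cV[R]_n) (u : nat -> T -> 'cV[R]_m) : Prop :=
  forall k, (l <= k < N)%N -> forall i : 'I_m,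
    meas_wrt (info l xi k) (fun t => u k t i 0) /\
    sq_integrable (fun t => u k t i 0).

Definition step (k : nat) (x : T -> 'cV[R]_n) (u : T -> 'cV[R]_m) : T -> 'cV[R]_n :=
  fun t =>
    cA D k *m x t + cAb D k *m Evec x + cB D k *m u t + cBb D k *m Evec u
    + w k t *: (cC D k *m x t + cCb D k *m Evec x + cD D k *m u t
                + cDb D k *m Evec u).

(* state_ l xi u j = x_{l+j} *)
Fixpoint state_ (l : nat) (xi : T -> 'cV[R]_n) (u : nat -> T -> 'cV[R]_m)
  (j : nat) : T -> 'cV[R]_n :=
  match j with
  | 0 => xi
  | j'.+1 => step (l + j') (state_ l xi u j') (u (l + j'))
  end.

(* x_k for k >= l *)
Definition state (l : nat) xi u (k : nat) : T -> 'cV[R]_n := state_ l xi u (k - l).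

Definition cost (l : nat) (xi : T -> 'cV[R]_n) (u : nat -> T -> 'cV[R]_m) : R :=
  Ex (fun t =>
    quad (cG D) (state l xi u N t) + quad (cGb D) (Evec (state l xi u N))
    + \sum_(l <= k < N)
        ( quad (cQ D k) (state l xi u k t)
        + 2 * bil (cS D k) (u k t) (state l xi u k t)
        + quad (cR D k) (u k t)
        + quad (cQb D k) (Evec (state l xi u k))
        + 2 * bil (cSb D k) (Evec (u k)) (Evec (state l xi u k))
        + quad (cRb D k) (Evec (u k)))).

(* state under the closed-loop strategy (Th, Thb, v): cl_state_ j = x*_{l+j} *)
Fixpoint cl_state_ (Th Thb : nat -> 'M[R]_(m, n)) (v : nat -> 'cV[R]_m)
  (l : nat) (xi : T -> 'cV[R]_n) (j : nat) : T -> 'cV[R]_n :=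
  match j with
  | 0 => xi
  | j'.+1 =>
      let k := (l + j')%N in
      let x := cl_state_ Th Thb v l xi j' in
      step k x (fun t => Th k *m x t + Thb k *m Evec x + v k)
  end.

Definition cl_ctrl (Th Thb : nat -> 'M[R]_(m, n)) (v : nat -> 'cV[R]_m)
  (l : nat) (xi : T -> 'cV[R]_n) : nat -> T -> 'cV[R]_m :=
  fun k t =>
    let x := cl_state_ Th Thb v l xi (k - l) in
    Th k *m x t + Thb k *m Evec x + v k.

Definition cl_optimal (l : nat) (Th Thb : nat -> 'M[R]_(m, n)) (v : nat -> 'cV[R]_m) : Prop :=
  forall xi, adm_init l xi ->
  forall u, adm_ctrl l xi u ->
    cost l xi (cl_ctrl Th Thb v l xi) <= cost l xi u.

Definition closed_loop_solvable : Prop :=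
  forall l, (l < N)%N ->
    exists (Th Thb : nat -> 'M[R]_(m, n)) (v : nat -> 'cV[R]_m), cl_optimal l Th Thb v.

Definition cost00_convex : Prop :=
  forall u1 u2, adm_ctrl 0 (fun _ => 0) u1 -> adm_ctrl 0 (fun _ => 0) u2 ->
  forall lam : R, 0 <= lam <= 1 ->
    cost 0 (fun _ => 0) (fun k t => lam *: u1 k t + (1 - lam) *: u2 k t)
    <= lam * cost 0 (fun _ => 0) u1 + (1 - lam) * cost 0 (fun _ => 0) u2.

End Stoch.

(* Main.v *)
(** The bound on the eps-gains lets them converge along an ultrafilter finer than [0^'+].
    The eps-Riccati recursion is polynomial in (P, Pi) and the gains, since
    [H' (Ups^eps)^-1 H = - H' Theta^eps]; so (P^eps, Pi^eps) converge too, and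
    [Ups Theta = - H], [Ups >= 0] pass to the limit.  This gives the range condition
    and the regularity of the limit.

    Optimality comes from completing squares.  With x = (x - E x) + E x and the conditional
    moments 0 and 1 of the noise, stage cost plus value at k+1 equals value at k plus
    E <Ups (u - Eu - Theta (x - Ex)), u - Eu - Theta (x - Ex)>
    + <Upsb (Eu - Thetab Ex), Eu - Thetab Ex>; summing over k, the cost is bounded below by
    the initial value, attained by u = Theta (x - Ex) + Thetab Ex. *)

Require Import Defs.
From HB Require Import structures.
From mathcomp Require Import all_boot all_order all_algebra.
From mathcomp Require Import all_classical all_reals all_analysis.
From mathcomp Require Import measurable_realfun ring lra.
Set Implicit Arguments. Unset Strict Implicit. Unset Printing Implicit Defensive.
Import Order.TTheory GRing.Theory Num.Theory.
Import numFieldNormedType.Exports.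
Local Open Scope classical_set_scope.
Local Open Scope ring_scope.

(** Two obstacles shape the proof. The Moore-Penrose inverse is not continuous, and the inverse of
    [Ups eps] may blow up as eps tends to 0. Limits are therefore taken only of gains, through the
    inverse-free system [GRE_gains], and a pseudoinverse [X] is inserted afterwards. The limit gain
    need not be [- X H]: every solution of [Ups Theta = - H] gives the same Riccati step, because
    [Ups X Ups = Ups].

    The second obstacle is probabilistic. States and controls are merely square-integrable, so
    products with the noise are not integrable a priori; and the noise is conditioned on past noise
    only, while controls also observe [xi]. Moments are first compared for the nonnegative
    integrands [(a + w)^2 f^2], where no integrability is required. This yields square-integrability
    of [w f]; then a = 0, a = 1 and polarization give the mixed moments. Conditioning on [xi] is
    added by a pi-lambda argument on intersections of an event of [xi] with an event of past
    noise. *)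

(** * Moore-Penrose inverses and invertibility of positive matrices *)

Lemma rowV_self_eq0 (R : realType) p (v : 'rV[R]_p) :
  (v *m v^T) 0 0 = 0 -> v = 0.
Proof.
rewrite mxE => v0; apply/rowP => j; rewrite mxE.
have : \sum_(i < p) v 0 i ^+ 2 = 0.
  by rewrite -[RHS]v0; apply: eq_bigr => i _; rewrite mxE expr2.
move/eqP; rewrite psumr_eq0; last by move=> i _; exact: sqr_ge0.
move=> /allP/(_ j); rewrite mem_index_enum => /(_ isT).
by rewrite /= sqrf_eq0 => /eqP.
Qed.

(** If [v W W'] vanishes then so does the squared length of [v W]; over the reals this forces
    [v W = 0], hence [v = 0]. *)
Lemma row_free_gram (R : realType) r p (W : 'M[R]_(r, p)) :
  row_free W -> W *m W^T \in unitmx.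
Proof.
move=> fW; rewrite -row_free_unit; apply: inj_row_free => v vWW.
have /eqP : v *m W = 0.
  by apply: rowV_self_eq0; rewrite trmx_mul mulmxA -(mulmxA v) vWW mul0mx mxE.
by rewrite mulmx_free_eq0 // => /eqP.
Qed.

(* For a full-rank factorization M = C W the pseudoinverse is
   W' (W W')^-1 (C' C)^-1 C'. *)
Lemma MP_inverse_full_rank (R : realType) p r (C : 'M[R]_(p, r)) (W : 'M[R]_(r, p)) :
  row_full C -> row_free W -> exists X, is_MP_inverse (C *m W) X.
Proof.
move=> fC fW; have uW := row_free_gram fW.
have uC : C^T *m C \in unitmx.
  rewrite -{2}(trmxK C); apply: row_free_gram.
  by rewrite /row_free mxrank_tr.
exists (W^T *m invmx (W *m W^T) *m invmx (C^T *m C) *m C^T).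
have MX : C *m W *m (W^T *m invmx (W *m W^T) *m invmx (C^T *m C) *m C^T)
          = C *m invmx (C^T *m C) *m C^T.
  by rewrite !mulmxA -(mulmxA C W) -(mulmxA C (W *m W^T)) mulmxV // mulmx1.
have XM : W^T *m invmx (W *m W^T) *m invmx (C^T *m C) *m C^T *m (C *m W)
          = W^T *m invmx (W *m W^T) *m W.
  by rewrite !mulmxA -(mulmxA _ C^T C) mulmxKV.
split.
- by rewrite MX !mulmxA -(mulmxA _ C^T C) mulmxKV.
- by rewrite XM !mulmxA -(mulmxA _ W W^T) mulmxKV.
- by rewrite MX !trmx_mul trmxK trmx_inv trmx_mul trmxK mulmxA.
- by rewrite XM !trmx_mul trmxK trmx_inv trmx_mul trmxK mulmxA.
Qed.

Lemma MP_inverse_exists (R : realType) p (M : 'M[R]_p) :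
  exists X, is_MP_inverse M X.
Proof.
rewrite -(mulmx_base M).
exact: MP_inverse_full_rank (col_base_full M) (row_base_free M).
Qed.

(** A vector in the left kernel makes the quadratic form vanish, so the lower bound kills it. As
    [invmx] returns a singular matrix unchanged, this is what makes the inverses of the eps-GRE
    genuine. *)
Lemma mx_geI_unit (R : realType) p (M : 'M[R]_p) (c : R) :
  0 < c -> mx_geI M c -> M \in unitmx.
Proof.
move=> c0 Mc; rewrite -row_free_unit; apply: inj_row_free => v vM0.
apply: rowV_self_eq0; apply: le_anti; apply/andP; split; last first.
  by rewrite mxE sumr_ge0 // => i _; rewrite mxE -expr2 sqr_ge0.
have := Mc v^T; rewrite /quad trmxK vM0 mul0mx [X in _ <= X]mxE.
by rewrite pmulr_rle0.
Qed.

(** * Bilinear forms and completion of squares *)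

Section Bilinear.
Context {R : realType}.

Definition bform p q (M : 'M[R]_(p, q)) (x : 'cV[R]_p) (y : 'cV[R]_q) : R :=
  (x^T *m M *m y) 0 0.

Lemma quadE p (M : 'M[R]_p) x : quad M x = bform M x x.
Proof. by []. Qed.

Lemma bilE p q (M : 'M[R]_(p, q)) u x : bil M u x = bform M x u.
Proof. by rewrite /bil /bform mulmxA. Qed.

Lemma bformDl p q (M : 'M[R]_(p, q)) x1 x2 y :
  bform M (x1 + x2) y = bform M x1 y + bform M x2 y.
Proof. by rewrite /bform linearD !mulmxDl mxE. Qed.

Lemma bformDr p q (M : 'M[R]_(p, q)) x y1 y2 :
  bform M x (y1 + y2) = bform M x y1 + bform M x y2.
Proof. by rewrite /bform mulmxDr mxE. Qed.

Lemma bformDm p q (M1 M2 : 'M[R]_(p, q)) x y :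
  bform (M1 + M2) x y = bform M1 x y + bform M2 x y.
Proof. by rewrite /bform mulmxDr mulmxDl mxE. Qed.

Lemma bformNl p q (M : 'M[R]_(p, q)) x y : bform M (- x) y = - bform M x y.
Proof. by rewrite /bform linearN !mulNmx mxE. Qed.

Lemma bformNr p q (M : 'M[R]_(p, q)) x y : bform M x (- y) = - bform M x y.
Proof. by rewrite /bform mulmxN mxE. Qed.

Lemma bformNm p q (M : 'M[R]_(p, q)) x y : bform (- M) x y = - bform M x y.
Proof. by rewrite /bform mulmxN mulNmx mxE. Qed.

Lemma bformZl p q (M : 'M[R]_(p, q)) a x y : bform M (a *: x) y = a * bform M x y.
Proof. by rewrite /bform linearZ -!scalemxAl mxE. Qed.

Lemma bformZr p q (M : 'M[R]_(p, q)) a x y : bform M x (a *: y) = a * bform M x y.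
Proof. by rewrite /bform -scalemxAr mxE. Qed.

Lemma bformMl p q r (M : 'M[R]_(p, q)) (A : 'M[R]_(p, r)) x y :
  bform M (A *m x) y = bform (A^T *m M) x y.
Proof. by rewrite /bform trmx_mul !mulmxA. Qed.

Lemma bformMr p q r (M : 'M[R]_(p, q)) (A : 'M[R]_(q, r)) x y :
  bform M x (A *m y) = bform (M *m A) x y.
Proof. by rewrite /bform !mulmxA. Qed.

Lemma bform_tr p q (M : 'M[R]_(p, q)) x y : bform M^T y x = bform M x y.
Proof.
rewrite /bform -[y^T *m _ *m _]trmxK [LHS]mxE.
by rewrite !trmx_mul !trmxK mulmxA.
Qed.

Lemma bform_sum p q (M : 'M[R]_(p, q)) x y :
  bform M x y = \sum_(i < p) \sum_(j < q) M i j * (x i 0 * y j 0).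
Proof.
rewrite /bform -mulmxA mxE; apply: eq_bigr => i _.
rewrite !mxE mulr_sumr; apply: eq_bigr => j _; ring.
Qed.

(** [U *m Th = - H] turns the cross terms of [quad U (u - Th *m x)] into twice u'Hx, and its pure
    state term into -x'H'Th x, which cancels the gain term of the new state weight. Drift and
    diffusion carry separate weights [Pi] and [P], so that one identity serves both the deviations,
    where the two weights coincide, and the means. *)
Lemma completion_of_squares n m (A C : 'M[R]_n) (B D : 'M[R]_(n, m))
    (Q P Pi : 'M[R]_n) (S : 'M[R]_(n, m)) (Rm U : 'M[R]_m)
    (H Th : 'M[R]_(m, n)) (x : 'cV[R]_n) (u : 'cV[R]_m) :
  P^T = P -> Pi^T = Pi -> U^T = U ->
  U = Rm + B^T *m Pi *m B + D^T *m P *m D ->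
  H = B^T *m Pi *m A + D^T *m P *m C + S^T ->
  U *m Th = - H ->
  quad Pi (A *m x + B *m u) + quad P (C *m x + D *m u)
    + (quad Q x + 2 * bil S u x + quad Rm u)
  = quad (Q + A^T *m Pi *m A + C^T *m P *m C + H^T *m Th) x
    + quad U (u - Th *m x).
Proof.
move=> sP sPi sU UE HE UTh.
have ThU : Th^T *m U = - H^T.
  by rewrite -{1}sU -trmx_mul UTh linearN.
have HT : H^T = A^T *m Pi *m B + C^T *m P *m D + S.
  by rewrite HE !linearD /= !trmx_mul !trmxK sP sPi !mulmxA.
rewrite !quadE bilE !bformDl !bformDr !bformNl !bformNr !bformMl !bformMr.
rewrite ThU UTh mulNmx !bformNm !bformDm -(bform_tr H) HT UE !bformDm.
have tP : bform (D^T *m P *m C) u x = bform (C^T *m P *m D) x u.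
  by rewrite -(bform_tr (C^T *m P *m D)) !trmx_mul trmxK sP mulmxA.
have tPi : bform (B^T *m Pi *m A) u x = bform (A^T *m Pi *m B) x u.
  by rewrite -(bform_tr (A^T *m Pi *m B)) !trmx_mul trmxK sPi mulmxA.
rewrite tP tPi; ring.
Qed.

End Bilinear.

(** * Entrywise limits of matrices along a filter *)

Section EntrywiseConvergence.
Context {R : realType} (F : set_system R) {FF : ProperFilter F}.

Record mxcvg p q (f : R -> 'M[R]_(p, q)) (A : 'M[R]_(p, q)) : Prop := MxCvg {
  mxcvgE : forall i j, f e i j @[e --> F] --> A i j }.

Lemma mxcvg_cst p q (A : 'M[R]_(p, q)) : mxcvg (fun=> A) A.
Proof. by split=> i j; exact: cvg_cst. Qed.

Lemma mxcvgD p q (f g : R -> 'M[R]_(p, q)) A B :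
  mxcvg f A -> mxcvg g B -> mxcvg (fun e => f e + g e) (A + B).
Proof.
move=> [fA] [gB]; split=> i j; rewrite mxE; under eq_fun do rewrite mxE.
exact: cvgD (fA i j) (gB i j).
Qed.

Lemma mxcvgN p q (f : R -> 'M[R]_(p, q)) A :
  mxcvg f A -> mxcvg (fun e => - f e) (- A).
Proof.
move=> [fA]; split=> i j; rewrite mxE; under eq_fun do rewrite mxE.
exact: cvgN (fA i j).
Qed.

Lemma mxcvg_tr p q (f : R -> 'M[R]_(p, q)) A :
  mxcvg f A -> mxcvg (fun e => (f e)^T) A^T.
Proof.
move=> [fA]; split=> i j; rewrite mxE; under eq_fun do rewrite mxE; exact: fA.
Qed.

Lemma mxcvgM p q r (f : R -> 'M[R]_(p, q)) (g : R -> 'M[R]_(q, r)) A B :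
  mxcvg f A -> mxcvg g B -> mxcvg (fun e => f e *m g e) (A *m B).
Proof.
move=> [fA] [gB]; split=> i j; rewrite mxE; under eq_fun do rewrite mxE.
apply: cvg_big => [|k _]; first exact: add_continuous.
by apply: cvgM; [exact: fA | exact: gB].
Qed.

Lemma mxcvg_scalar p (f : R -> R) a :
  f e @[e --> F] --> a -> mxcvg (fun e => (f e)%:M : 'M[R]_p) (a%:M : 'M[R]_p).
Proof.
move=> fa; split=> i j; rewrite mxE; under eq_fun do rewrite mxE.
by case: (i == j); rewrite ?mulr1n ?mulr0n //; exact: cvg_cst.
Qed.

Lemma mxcvg_unique p q (f : R -> 'M[R]_(p, q)) A B :
  mxcvg f A -> mxcvg f B -> A = B.
Proof.
move=> [fA] [fB]; apply/matrixP => i j.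
exact: (cvg_unique (@Rhausdorff R) (fA i j) (fB i j)).
Qed.

Lemma mxcvg_near_eq p q (f g : R -> 'M[R]_(p, q)) A :
  (\forall e \near F, f e = g e) -> mxcvg f A -> mxcvg g A.
Proof.
move=> fg [fA]; split=> i j; apply: cvg_trans (fA i j); apply: near_eq_cvg.
by apply: filterS fg => e ->.
Qed.

(** For a fixed [v] both sides of the inequality are convergent real functions of [e], and the left
    one tends to 0. *)
Lemma mx_geI_lim p (f : R -> 'M[R]_p) A :
  e @[e --> F] --> (0 : R) -> mxcvg f A ->
  (\forall e \near F, mx_geI (f e) e) -> mx_geI A 0.
Proof.
move=> F0 fA fge v.
apply: (@ler_cvg_to R F FF R (fun e => e * (v^T *m v) 0 0)
          (fun e => quad (f e) v)).
- by apply: cvgM => //; exact: cvg_cst.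
- have := mxcvgM (mxcvgM (@mxcvg_cst _ _ v^T) fA) (@mxcvg_cst _ _ v).
  by case=> /(_ 0 0).
- by apply: filterS fge => e; exact.
Qed.

End EntrywiseConvergence.

(** Compactness of [-M, M] gives a cluster point of the image filter. For a neighbourhood [B] of it,
    the ultrafilter contains the preimage of [B] or of its complement; the second is excluded since
    the complement misses [B]. *)
Lemma ultra_bounded_cvg (R : realType) (F : set_system R) (f : R -> R) (M : R) :
  UltraFilter F -> (\forall e \near F, `|f e| <= M) ->
  exists a : R, f e @[e --> F] --> a.
Proof.
move=> UF fM.
have PF : ProperFilter F by exact: ultra_proper.
have [|a [_ ca]] := @segment_compact R (- M) M (fmap f F) _.
  by apply: filterS fM => e /=; rewrite in_itv /= ler_norml.
exists a => B aB; have [//|nB] := in_ultra_setVsetC (f @^-1` B) UF.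
have nB' : fmap f F (~` B) by [].
by have [y []] := ca _ _ nB' aB.
Qed.

Lemma frob2_ge0 (R : realType) p q (M : 'M[R]_(p, q)) : 0 <= frob2 M.
Proof. by apply: sumr_ge0 => i _; apply: sumr_ge0 => j _; exact: sqr_ge0. Qed.

Lemma sqr_entry_le_frob2 (R : realType) p q (M : 'M[R]_(p, q)) i j :
  M i j ^+ 2 <= frob2 M.
Proof.
rewrite /frob2 (bigD1 i) //= (bigD1 j) //= -addrA lerDl addr_ge0 //.
  by apply: sumr_ge0 => k _; exact: sqr_ge0.
by apply: sumr_ge0 => k _; apply: sumr_ge0 => k' _; exact: sqr_ge0.
Qed.

Lemma ultra_frob2_bounded_cvg (R : realType) (F : set_system R) p q
    (f : R -> 'M[R]_(p, q)) (M : R) :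
  UltraFilter F -> (\forall e \near F, frob2 (f e) <= M) ->
  exists A, mxcvg F f A.
Proof.
move=> UF fM.
have PF : ProperFilter F by exact: ultra_proper.
have /choice[a fa] (ij : 'I_p * 'I_q) : exists a : R, f e ij.1 ij.2 @[e --> F] --> a.
  (* The bound [M + 1] avoids a square root: y <= y^2 + 1 for every real y. *)
  apply: (@ultra_bounded_cvg _ _ _ (M + 1) UF); apply: filterS fM => e feM.
  have := sqr_entry_le_frob2 (f e) ij.1 ij.2.
  rewrite -[_ ^+ 2]real_normK ?num_real //.
  by have := normr_ge0 (f e ij.1 ij.2); nra.
by exists (\matrix_(i, j) a (i, j)); split=> i j; rewrite mxE; exact: (fa (i, j)).
Qed.

(** * Limit of the eps-Riccati recursion and regularity of the limit *)

Section RiccatiLimit.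
Context {R : realType} {n m : nat} (D : MFLQdata R n m).

(** The GRE with the pseudoinverse eliminated: the gains are unknowns constrained by linear
    equations. These equations contain the range conditions and are stable under limits. *)
Definition GRE_gains (N : nat) (P Pi : nat -> 'M[R]_n)
    (Th Thb : nat -> 'M[R]_(m, n)) : Prop :=
  [/\ P N = cG D, Pi N = cG D + cGb D & forall k, (k < N)%N ->
   [/\ Ups D 0 (P k.+1) k *m Th k = - Hm D (P k.+1) k,
       Upsb D 0 (P k.+1) (Pi k.+1) k *m Thb k = - Hmb D (P k.+1) (Pi k.+1) k,
       P k = cQ D k + (cA D k)^T *m P k.+1 *m cA D k
             + (cC D k)^T *m P k.+1 *m cC D k + (Hm D (P k.+1) k)^T *m Th k,
       Pi k = cQ D k + cQb D k
             + (cA D k + cAb D k)^T *m Pi k.+1 *m (cA D k + cAb D k)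
             + (cC D k + cCb D k)^T *m P k.+1 *m (cC D k + cCb D k)
             + (Hmb D (P k.+1) (Pi k.+1) k)^T *m Thb k &
       mx_geI (Ups D 0 (P k.+1) k) 0 /\
       mx_geI (Upsb D 0 (P k.+1) (Pi k.+1) k) 0]].

Section Limits.
Context (F : set_system R) {FF : ProperFilter F} (P Pi : R -> 'M[R]_n) (P0 Pi0 : 'M[R]_n).
Hypotheses (F0 : e @[e --> F] --> (0 : R)) (PP0 : mxcvg F P P0) (PiPi0 : mxcvg F Pi Pi0).

Ltac mxcvg_tac := repeat lazymatch goal with
  | |- mxcvg _ (fun _ => ?A) _ => exact: mxcvg_cst
  | |- mxcvg _ (fun e => (@?f e) + (@?g e)) _ => refine (mxcvgD (f := f) (g := g) _ _)
  | |- mxcvg _ (fun e => (@?f e) *m (@?g e)) _ => refine (mxcvgM (f := f) (g := g) _ _)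
  | |- mxcvg _ (fun e => (@?f e)^T) _ => refine (mxcvg_tr (f := f) _)
  | |- mxcvg _ (fun e => e%:M) _ => exact: (mxcvg_scalar _ F0)
  | |- _ => eassumption
  end.

Lemma mxcvg_Hm k : mxcvg F (fun e => Hm D (P e) k) (Hm D P0 k).
Proof. rewrite /Hm; mxcvg_tac. Qed.

Lemma mxcvg_Hmb k : mxcvg F (fun e => Hmb D (P e) (Pi e) k) (Hmb D P0 Pi0 k).
Proof. rewrite /Hmb; mxcvg_tac. Qed.

Lemma mxcvg_Ups k : mxcvg F (fun e => Ups D e (P e) k) (Ups D 0 P0 k).
Proof. rewrite /Ups; mxcvg_tac. Qed.

Lemma mxcvg_Upsb k :
  mxcvg F (fun e => Upsb D e (P e) (Pi e) k) (Upsb D 0 P0 Pi0 k).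
Proof. rewrite /Upsb; mxcvg_tac. Qed.

(** Only the product of [X e] with [Hm] is assumed to converge, never [X e] itself, which may be
    unbounded. *)
Lemma mxcvg_Pstep k (X : R -> 'M[R]_m) (Th0 : 'M[R]_(m, n)) :
  mxcvg F (fun e => - (X e *m Hm D (P e) k)) Th0 ->
  mxcvg F (fun e => Pstep D (P e) (X e) k)
    (cQ D k + (cA D k)^T *m P0 *m cA D k + (cC D k)^T *m P0 *m cC D k
     + (Hm D P0 k)^T *m Th0).
Proof.
move=> XTh.
have -> : (fun e => Pstep D (P e) (X e) k) =
    (fun e => cQ D k + (cA D k)^T *m P e *m cA D k + (cC D k)^T *m P e *m cC D k
              + (Hm D (P e) k)^T *m (- (X e *m Hm D (P e) k))).
  by apply/funext => e; rewrite mulmxN mulmxA.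
have := @mxcvg_Hm k => ?; mxcvg_tac.
Qed.

Lemma mxcvg_Pistep k (X : R -> 'M[R]_m) (Th0 : 'M[R]_(m, n)) :
  mxcvg F (fun e => - (X e *m Hmb D (P e) (Pi e) k)) Th0 ->
  mxcvg F (fun e => Pistep D (P e) (Pi e) (X e) k)
    (cQ D k + cQb D k
     + (cA D k + cAb D k)^T *m Pi0 *m (cA D k + cAb D k)
     + (cC D k + cCb D k)^T *m P0 *m (cC D k + cCb D k)
     + (Hmb D P0 Pi0 k)^T *m Th0).
Proof.
move=> XTh.
have -> : (fun e => Pistep D (P e) (Pi e) (X e) k) =
    (fun e => cQ D k + cQb D k
       + (cA D k + cAb D k)^T *m Pi e *m (cA D k + cAb D k)
       + (cC D k + cCb D k)^T *m P e *m (cC D k + cCb D k)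
       + (Hmb D (P e) (Pi e) k)^T *m (- (X e *m Hmb D (P e) (Pi e) k))).
  by apply/funext => e; rewrite mulmxN mulmxA.
have := @mxcvg_Hmb k => ?; mxcvg_tac.
Qed.

End Limits.

Lemma epsGRE_limit (N : nat) (Peps Pieps : R -> nat -> 'M[R]_n) :
  (forall eps : R, 0 < eps ->
     epsGRE_strongly_regular_solution D N eps (Peps eps) (Pieps eps)) ->
  (exists M : R, forall eps : R, 0 < eps ->
     \sum_(0 <= k < N) (frob2 (Theta_eps D eps (Peps eps) k)
       + frob2 (Thetab_eps D eps (Peps eps) (Pieps eps) k)) <= M) ->
  exists P Pi Th Thb, GRE_gains N P Pi Th Thb.
Proof.
move=> sol [M bndM].
(* Every bounded real function converges along an ultrafilter, so all gain entries at all times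
   converge along the same [F], without successive extractions. *)
have [F [UF sF]] := ultraFilterLemma (at_right_proper_filter (0 : R)).
have FF : ProperFilter F by exact: ultra_proper.
have F0 : e @[e --> F] --> (0 : R).
  by move=> A nA; apply: sF; apply: filterS nA => x Ax _.
have Fpos : \forall e \near F, 0 < e.
  by apply: sF; exact: nbhs_right_gt.
have bnd k : (k < N)%N -> \forall e \near F,
    frob2 (Theta_eps D e (Peps e) k) <= M /\
    frob2 (Thetab_eps D e (Peps e) (Pieps e) k) <= M.
  move=> kN; apply: filterS Fpos => e e0.
  have := bndM e e0; rewrite big_mkord (bigD1 (Ordinal kN)) //=.
  set s := \sum_(i < N | _) _.
  have s0 : 0 <= s by apply: sumr_ge0 => i _; rewrite addr_ge0 ?frob2_ge0.
  have := frob2_ge0 (Theta_eps D e (Peps e) k).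
  have := frob2_ge0 (Thetab_eps D e (Peps e) (Pieps e) k).
  by move=> ? ? ?; split; lra.
(* A limit is available only for [k < N]. Placing this condition inside the existential lets
   [choice] return a total function, with 0 as a dummy value past the horizon. *)
have /choice[Th ThP] k : exists A, (k < N)%N ->
    mxcvg F (fun e => Theta_eps D e (Peps e) k) A.
  have [kN|] := boolP (k < N)%N; last by exists 0.
  have [|A fA] := @ultra_frob2_bounded_cvg _ F _ _
    (fun e => Theta_eps D e (Peps e) k) M UF; last by exists A.
  by apply: filterS (bnd k kN) => e [].
have /choice[Thb ThbP] k : exists A, (k < N)%N ->
    mxcvg F (fun e => Thetab_eps D e (Peps e) (Pieps e) k) A.
  have [kN|] := boolP (k < N)%N; last by exists 0.
  have [|A fA] := @ultra_frob2_bounded_cvg _ F _ _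
    (fun e => Thetab_eps D e (Peps e) (Pieps e) k) M UF; last by exists A.
  by apply: filterS (bnd k kN) => e [].
have stepP k A : (k < N)%N -> mxcvg F (Peps ^~ k.+1) A ->
    mxcvg F (Peps ^~ k) (cQ D k + (cA D k)^T *m A *m cA D k
      + (cC D k)^T *m A *m cC D k + (Hm D A k)^T *m Th k).
  move=> kN PA; refine (mxcvg_near_eq _ (mxcvg_Pstep PA (ThP k kN))).
  apply: filterS Fpos => e /sol[_ [_ /(_ k kN)]].
  by case=> ->.
have stepPi k A B : (k < N)%N -> mxcvg F (Peps ^~ k.+1) A ->
    mxcvg F (Pieps ^~ k.+1) B -> mxcvg F (Pieps ^~ k)
     (cQ D k + cQb D k
     + (cA D k + cAb D k)^T *m B *m (cA D k + cAb D k)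
     + (cC D k + cCb D k)^T *m A *m (cC D k + cCb D k)
     + (Hmb D A B k)^T *m Thb k).
  move=> kN PA PB; refine (mxcvg_near_eq _ (mxcvg_Pistep PA PB (ThbP k kN))).
  apply: filterS Fpos => e /sol[_ [_ /(_ k kN)]].
  by case=> _ ->.
have cvgN : mxcvg F (Peps ^~ N) (cG D) /\ mxcvg F (Pieps ^~ N) (cG D + cGb D).
  split; [refine (mxcvg_near_eq _ (@mxcvg_cst _ F _ _ _ (cG D)))
         |refine (mxcvg_near_eq _ (@mxcvg_cst _ F _ _ _ (cG D + cGb D)))].
  - by apply: filterS Fpos => e /sol[].
  - by apply: filterS Fpos => e /sol[_ []].
(* Backward induction in time, [j] being the distance to the horizon. Both limits are carried
   together because the [Pi] step involves the limit of [P] at the later time. *)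
have cvgk j : (j <= N)%N -> exists A B,
    mxcvg F (Peps ^~ (N - j)%N) A /\ mxcvg F (Pieps ^~ (N - j)%N) B.
  elim: j => [_|j IH jN].
    by rewrite subn0; exists (cG D), (cG D + cGb D).
  have [A [B [PA PB]]] := IH (ltnW jN).
  have E : (N - j = (N - j.+1).+1)%N by rewrite subnSK.
  have kN : (N - j.+1 < N)%N by rewrite ltn_subrL (leq_trans _ jN).
  move: PA PB; rewrite E => PA PB.
  by eexists; eexists; split; [exact: stepP PA|exact: stepPi PA PB].
have /choice[PPi PPiP] k : exists AB : 'M[R]_n * 'M[R]_n, (k <= N)%N ->
    mxcvg F (Peps ^~ k) AB.1 /\ mxcvg F (Pieps ^~ k) AB.2.
  have [kN|] := boolP (k <= N)%N; last by exists (0, 0).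
  have [|A [B AB]] := cvgk (N - k)%N; first exact: leq_subr.
  by exists (A, B) => _; move: AB; rewrite subKn.
exists (fun k => (PPi k).1), (fun k => (PPi k).2), Th, Thb; split.
- exact: (mxcvg_unique (PPiP N (leqnn N)).1 cvgN.1).
- exact: (mxcvg_unique (PPiP N (leqnn N)).2 cvgN.2).
move=> k kN; have [PA PB] := PPiP k.+1 kN.
have [PkA PkB] := PPiP k (ltnW kN).
have gU : \forall e \near F, mx_geI (Ups D e (Peps e k.+1) k) e.
  by apply: filterS Fpos => e /sol[_ [_ /(_ k kN)[]]].
have gUb : \forall e \near F, mx_geI (Upsb D e (Peps e k.+1) (Pieps e k.+1) k) e.
  by apply: filterS Fpos => e /sol[_ [_ /(_ k kN)[]]].
split.
(* For [e > 0] the product of [Ups] with the gain is exactly [- Hm], so two expressions of one limit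
   are compared; the inverse cancels before the limit is taken. *)
- refine (mxcvg_unique (mxcvgM (mxcvg_Ups F0 PA k) (ThP k kN)) _).
  refine (mxcvg_near_eq _ (mxcvgN (mxcvg_Hm PA k))).
  apply: filterS2 Fpos gU => e e0 /(mx_geI_unit e0) u.
  by rewrite /Theta_eps mulmxN mulmxA mulmxV // mul1mx.
- refine (mxcvg_unique (mxcvgM (mxcvg_Upsb F0 PA PB k) (ThbP k kN)) _).
  refine (mxcvg_near_eq _ (mxcvgN (mxcvg_Hmb PA PB k))).
  apply: filterS2 Fpos gUb => e e0 /(mx_geI_unit e0) u.
  by rewrite /Thetab_eps mulmxN mulmxA mulmxV // mul1mx.
- exact: mxcvg_unique PkA (stepP _ _ kN PA).
- exact: mxcvg_unique PkB (stepPi _ _ _ kN PA PB).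
- split; first exact: mx_geI_lim F0 (mxcvg_Ups F0 PA k) gU.
  exact: mx_geI_lim F0 (mxcvg_Upsb F0 PA PB k) gUb.
Qed.

Lemma Ups_sym k (P : 'M[R]_n) : MFLQ_symmetric D -> P^T = P ->
  (Ups D 0 P k)^T = Ups D 0 P k.
Proof.
move=> [_ [_ [sR _]]] sP.
by rewrite /Ups !linearD /= !trmx_mul trmxK tr_scalar_mx sR trmxK sP !mulmxA.
Qed.

Lemma Upsb_sym k (P Pi : 'M[R]_n) : MFLQ_symmetric D -> P^T = P -> Pi^T = Pi ->
  (Upsb D 0 P Pi k)^T = Upsb D 0 P Pi k.
Proof.
move=> [_ [_ [sR [sRb _]]]] sP sPi.
rewrite /Upsb; move: (cB D k + cBb D k) (cD D k + cDb D k) => B C.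
by rewrite !linearD /= !trmx_mul tr_scalar_mx sR sRb sP sPi !trmxK !mulmxA.
Qed.

(** The right-hand side is visibly symmetric, which is how symmetry of [P] and [Pi] propagates
    backwards. *)
Lemma trmx_mul_gain p q (U : 'M[R]_p) (H Th : 'M[R]_(p, q)) :
  U^T = U -> U *m Th = - H -> H^T *m Th = - (Th^T *m U *m Th).
Proof.
move=> sU UTh; suff -> : H^T = - (Th^T *m U) by rewrite mulNmx.
by have := congr1 trmx UTh; rewrite trmx_mul sU => ->; rewrite linearN opprK.
Qed.

(** Substituting [H = - U Th] gives Th'U X U Th, and [U X U = U] removes [X]. Hence the recursion
    written with gains is the one written with the pseudoinverse. *)
Lemma MP_inverse_gain p q (U X : 'M[R]_p) (H Th : 'M[R]_(p, q)) :
  is_MP_inverse U X -> U^T = U -> U *m Th = - H ->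
  H^T *m X *m H = - (H^T *m Th).
Proof.
move=> [UXU _ _ _] sU UTh.
have -> : H = - (U *m Th) by rewrite UTh opprK.
rewrite [(- _)^T]linearN /= trmx_mul sU !mulNmx mulmxN opprK.
by rewrite opprK mulmxA -2!(mulmxA Th^T) UXU.
Qed.

Lemma GRE_gains_sym N P Pi Th Thb : MFLQ_symmetric D ->
  GRE_gains N P Pi Th Thb ->
  forall k, (k <= N)%N -> (P k)^T = P k /\ (Pi k)^T = Pi k.
Proof.
move=> symD [PN PiN rec] k kN.
have [sQ [sQb [_ [_ [sG sGb]]]]] := symD.
rewrite -(subKn kN); elim: (N - k)%N (leq_subr k N) => [_|j IH jN].
  by rewrite subn0 PN PiN linearD /= sG sGb.
have [sP sPi] := IH (ltnW jN).
have iN : (N - j.+1 < N)%N by rewrite ltn_subrL (leq_trans _ jN).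
have [] := rec _ iN; rewrite !subnSK //.
set i := (N - j.+1)%N => U Ub -> -> _; split.
  have sU := Ups_sym i symD sP.
  rewrite (trmx_mul_gain sU U); move: (Ups _ _ _ _) sU {U} => U sU.
  rewrite !linearD linearN /= !trmx_mul !trmxK.
  by rewrite sQ sP sU !mulmxA.
have sU := Upsb_sym i symD sP sPi.
rewrite (trmx_mul_gain sU Ub); move: (Upsb _ _ _ _ _) sU {Ub} => Ub sU.
move: (cA D i + cAb D i) (cC D i + cCb D i) => A C.
rewrite !linearD linearN /= !trmx_mul !trmxK.
by rewrite sQ sQb sP sPi sU !mulmxA.
Qed.

Lemma GRE_gains_regular N P Pi Th Thb : MFLQ_symmetric D ->
  GRE_gains N P Pi Th Thb -> GRE_regular_solution D N P Pi.
Proof.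
move=> symD gains; have sym := GRE_gains_sym symD gains.
have [PN PiN rec] := gains; split=> //; split=> // k kN.
have [sP sPi] := sym k.+1 kN.
have [U Ub PE PiE [U0 Ub0]] := rec k kN.
have sU := Ups_sym k symD sP; have sUb := Upsb_sym k symD sP sPi.
have [X UX] := MP_inverse_exists (Ups D 0 (P k.+1) k).
have [Xb UXb] := MP_inverse_exists (Upsb D 0 (P k.+1) (Pi k.+1) k).
exists X, Xb; split=> //; split=> //; split.
  by rewrite PE /Pstep (MP_inverse_gain UX sU U) opprK.
split; first by rewrite PiE /Pistep (MP_inverse_gain UXb sUb Ub) opprK.
split=> //; split=> //; split.
  (* Inclusion of column ranges is encoded by row spaces of transposes; the multiplier comes from
     transposing [Ups Th = - Hm]. *)
  by apply/submxP; exists (- (Th k)^T); rewrite mulNmx -trmx_mul U linearN opprK.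
by apply/submxP; exists (- (Thb k)^T); rewrite mulNmx -trmx_mul Ub linearN opprK.
Qed.

End RiccatiLimit.

(** * Conditional moments of the noise against square-integrable factors *)

Section ConditionalMoments.
Context {d : measure_display} {T : measurableType d} {R : realType}.
Variable P : probability T R.
Import HBNNSimple.

Section SubSigmaAlgebra.
Variables (F : set (set T)) (phi1 phi2 h : T -> R).
Hypotheses (mphi1 : measurable_fun setT phi1) (mphi2 : measurable_fun setT phi2).
Hypotheses (phi1_ge0 : forall t, 0 <= phi1 t) (phi2_ge0 : forall t, 0 <= phi2 t).
Hypotheses (mh : measurable_fun setT h) (h_ge0 : forall t, 0 <= h t).
Hypothesis hF : meas_wrt F h.
Hypothesis eqF : forall A, F A ->
  (\int[P]_(t in A) (phi1 t)%:E = \int[P]_(t in A) (phi2 t)%:E)%E.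

Let integral_indic_comp (phi : T -> R) (B : set R) :
  (\int[P]_t (phi t * \1_B (h t))%:E = \int[P]_(t in h @^-1` B) (phi t)%:E)%E.
Proof.
rewrite [RHS]integral_mkcond; apply: eq_integral => t _.
rewrite /patch indicE.
have -> : (t \in h @^-1` B) = (h t \in B) by apply/idP/idP; rewrite !inE.
by case: ifP => _; rewrite ?mulr1 ?mulr0.
Qed.

Let integral_simple (g : {nnsfun R >-> R}) :
  (\int[P]_t (phi1 t * g (h t))%:E = \int[P]_t (phi2 t * g (h t))%:E)%E.
Proof.
have mi r : measurable_fun setT (fun t => \1_(g @^-1` [set r]) (h t) : R).
  by apply: measurableT_comp => //; exact: measurable_indic.
have ri0 r t : 0 <= r * \1_(g @^-1` [set r]) (h t).
  have [r0|r0] := leP 0 r; first by rewrite mulr_ge0 // indicE ler0n.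
  rewrite indicE memNset ?mulr0 //= => gr.
  by move: r0; rewrite -gr ltNge fun_ge0.
have E (phi : T -> R) : measurable_fun setT phi -> (forall t, 0 <= phi t) ->
    (\int[P]_t (phi t * g (h t))%:E =
     \sum_(r \in range g) \int[P]_t (phi t * (r * \1_(g @^-1` [set r]) (h t)))%:E)%E.
  move=> mphi phi0; rewrite -ge0_integral_fsum //.
  - apply: eq_integral => t _; rewrite {1}(fimfunE g) !fsbig_finite //=.
    by rewrite mulr_sumr -sumEFin.
  - by move=> r; apply/measurable_EFinP; apply: measurable_funM => //; exact: measurable_funM.
  - by move=> r t _; rewrite lee_fin mulr_ge0.
rewrite (E _ mphi1 phi1_ge0) (E _ mphi2 phi2_ge0); apply: eq_fsbigr => r _.
have [r0|r0] := leP 0 r; last first.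
  suff -> : g @^-1` [set r] = set0.
    by apply: eq_integral => t _; rewrite indic0 !mulr0.
  rewrite -subset0 => y /= gr.
  by move: r0; rewrite -gr ltNge fun_ge0.
have Z (phi : T -> R) : measurable_fun setT phi -> (forall t, 0 <= phi t) ->
    (\int[P]_t (phi t * (r * \1_(g @^-1` [set r]) (h t)))%:E =
     r%:E * \int[P]_(t in h @^-1` (g @^-1` [set r])) (phi t)%:E)%E.
  move=> mphi phi0; rewrite -integral_indic_comp -ge0_integralZl_EFin //.
  - by apply: eq_integral => t _; rewrite -EFinM mulrCA.
  - by move=> t _; rewrite lee_fin mulr_ge0 // indicE ler0n.
  - by apply/measurable_EFinP; exact: measurable_funM.
rewrite (Z _ mphi1 phi1_ge0) (Z _ mphi2 phi2_ge0); congr (_ * _)%E.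
by apply: eqF; exact: hF.
Qed.

(** Equality on the sets of [F] extends to nonnegative [F]-measurable weights by simple functions
    and monotone convergence. The identity of the real line is approximated and then composed with
    [h], so that every level set is a preimage under [h] and thus lies in [F]. *)
Lemma integral_mul_eq :
  (\int[P]_t (phi1 t * h t)%:E = \int[P]_t (phi2 t * h t)%:E)%E.
Proof.
(* The approximation is monotone for nonnegative functions, hence the positive part of the identity;
   it changes nothing at the values of [h]. *)
have mpos : measurable_fun setT (fun y : R => (Num.max y 0)%:E).
  by apply/measurable_EFinP; exact: measurable_maxr.
pose g := nnsfun_approx measurableT mpos.
have E (phi : T -> R) : measurable_fun setT phi -> (forall t, 0 <= phi t) ->
    (\int[P]_t (phi t * h t)%:E = limn (fun n => \int[P]_t (phi t * g n (h t))%:E))%E.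
  move=> mphi phi0; rewrite -monotone_convergence //.
  - apply: eq_integral => t _; apply/esym/cvg_lim => //.
    under eq_fun do rewrite EFinM; rewrite EFinM.
    apply: cvgeZl => //.
    have := @cvg_nnsfun_approx _ _ _ _ measurableT _ mpos _ (h t) I.
    by rewrite /= max_l //; apply => x _; rewrite lee_fin le_max lexx orbT.
  - move=> n; apply/measurable_EFinP; apply: measurable_funM => //.
    exact: measurableT_comp.
  - by move=> n t _; rewrite lee_fin mulr_ge0.
  - move=> t _ m n mn; rewrite lee_fin ler_wpM2l //.
    by have /lefP := @nd_nnsfun_approx _ _ _ _ measurableT _ mpos _ _ mn.
rewrite (E _ mphi1 phi1_ge0) (E _ mphi2 phi2_ge0).
by congr (limn _); apply/funext => n; exact: integral_simple.
Qed.

End SubSigmaAlgebra.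
Definition real_integrable (f : T -> R) := P.-integrable setT (EFin \o f).

Lemma integrableD_real f g : real_integrable f -> real_integrable g ->
  real_integrable (fun t => f t + g t).
Proof.
move=> fi gi; rewrite /real_integrable.
rewrite (_ : EFin \o _ = ((EFin \o f) \+ (EFin \o g))%E) //.
exact: integrableD.
Qed.

Lemma integrableZ_real a f : real_integrable f -> real_integrable (fun t => a * f t).
Proof.
move=> fi; rewrite /real_integrable.
rewrite (_ : EFin \o _ = (fun t => a%:E * (EFin \o f) t)%E) //.
exact: integrableZl.
Qed.

Lemma integrable_cst_real a : real_integrable (fun=> a).
Proof. exact: finite_measure_integrable_cst. Qed.

Lemma integrable_sum_real I (r : seq I) (f : I -> T -> R) :
  (forall i, real_integrable (f i)) ->
  real_integrable (fun t => \sum_(i <- r) f i t).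
Proof.
move=> fi; elim: r => [|i r IH].
  by under eq_fun do rewrite big_nil; exact: integrable_cst_real.
by under eq_fun do rewrite big_cons; exact: integrableD_real.
Qed.

Lemma ExD f g : real_integrable f -> real_integrable g ->
  Ex P (fun t => f t + g t) = Ex P f + Ex P g.
Proof. by move=> fi gi; rewrite /Ex RintegralD. Qed.

Lemma ExZ a f : real_integrable f -> Ex P (fun t => a * f t) = a * Ex P f.
Proof. by move=> fi; rewrite /Ex RintegralZl. Qed.

Lemma Ex_cst a : Ex P (fun=> a) = a.
Proof.
rewrite /Ex Rintegral_cst // [X in fine X](_ : _ = 1%E) ?mulr1 //.
exact: probability_setT. Qed.

Lemma Ex_ge0 f : (forall t, 0 <= f t) -> 0 <= Ex P f.
Proof. by move=> f0; apply: Rintegral_ge0. Qed.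

Lemma Ex_sum I (r : seq I) (f : I -> T -> R) : (forall i, real_integrable (f i)) ->
  Ex P (fun t => \sum_(i <- r) f i t) = \sum_(i <- r) Ex P (f i).
Proof.
move=> fi; elim: r => [|i r IH].
  by rewrite big_nil; under eq_fun do rewrite big_nil; exact: Ex_cst.
rewrite big_cons -IH -ExD //; last exact: integrable_sum_real.
by congr (Ex P _); apply/funext => t; rewrite big_cons.
Qed.

Lemma sq_integrable_mul f g : sq_integrable P f -> sq_integrable P g ->
  real_integrable (fun t => f t * g t).
Proof.
move=> [mf fi] [mg gi].
apply: (@le_integrable _ _ _ P setT measurableT _ (EFin \o (fun t => f t ^+ 2 + g t ^+ 2))).
- by apply/measurable_EFinP; exact: measurable_funM.
- move=> t _ /=; rewrite lee_fin [leRHS]ger0_norm ?addr_ge0 ?sqr_ge0 //.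
  rewrite normrM -[f t ^+ 2]real_normK ?num_real // -[g t ^+ 2]real_normK ?num_real //.
  have := normr_ge0 (f t); have := normr_ge0 (g t); nra.
- exact: integrableD_real fi gi.
Qed.

Lemma sq_integrableD f g : sq_integrable P f -> sq_integrable P g ->
  sq_integrable P (fun t => f t + g t).
Proof.
move=> fs gs; split; first by apply: measurable_funD; [case: fs | case: gs].
have -> : (fun t => ((f t + g t) ^+ 2)%:E) =
    EFin \o (fun t => (f t ^+ 2 + g t ^+ 2) + 2 * (f t * g t)).
  by apply/funext => t /=; congr EFin; ring.
apply: integrableD_real; last exact/integrableZ_real/sq_integrable_mul.
by apply: integrableD_real; [case: fs | case: gs].
Qed.

Lemma sq_integrableZ a f : sq_integrable P f -> sq_integrable P (fun t => a * f t).
Proof.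
move=> [mf fi]; split; first exact: measurable_funM.
have -> : (fun t => ((a * f t) ^+ 2)%:E) = EFin \o (fun t => a ^+ 2 * f t ^+ 2).
  by apply/funext => t /=; rewrite exprMn.
exact: integrableZ_real.
Qed.

Lemma sq_integrable_cst a : sq_integrable P (fun=> a).
Proof. by split; [exact: measurable_cst | exact: integrable_cst_real]. Qed.

Lemma sq_integrable_integrable f : sq_integrable P f -> real_integrable f.
Proof.
move=> fs; have := sq_integrable_mul fs (sq_integrable_cst 1).
by under eq_fun do rewrite mulr1.
Qed.

(** Gives access to the closure properties of measurable functions by viewing [T] with the generated
    sigma-algebra. *)
Lemma meas_wrtP (G : set (set T)) (f : T -> R) :
  meas_wrt <<s G>> f <-> measurable_fun setT (f : g_sigma_algebraType G -> R).
Proof.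
split=> [mf _ B mB|mf B mB]; first by rewrite setTI; exact: mf.
by have := mf measurableT B mB; rewrite setTI.
Qed.

Definition L2_wrt (G : set (set T)) (f : T -> R) :=
  meas_wrt <<s G>> f /\ sq_integrable P f.

Lemma L2_wrtD G f g : L2_wrt G f -> L2_wrt G g -> L2_wrt G (fun t => f t + g t).
Proof.
move=> [/meas_wrtP mf fs] [/meas_wrtP mg gs]; split; last exact: sq_integrableD.
by apply/meas_wrtP; exact: measurable_funD.
Qed.

Lemma L2_wrtZ G a f : L2_wrt G f -> L2_wrt G (fun t => a * f t).
Proof.
move=> [/meas_wrtP mf fs]; split; last exact: sq_integrableZ.
by apply/meas_wrtP; exact: measurable_funM.
Qed.

Lemma L2_wrt_cst G a : L2_wrt G (fun=> a).
Proof.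
split; last exact: sq_integrable_cst.
by apply/meas_wrtP; exact: measurable_cst.
Qed.

(* The conditions E[w | G] = 0 and E[w^2 | G] = 1, packed into E[(a + w)^2 | G] = a^2 + 1
   so that only nonnegative integrands occur. *)
Definition unit_noise (G : set (set T)) (w : T -> R) :=
  [/\ sq_integrable P w, (forall A, <<s G>> A -> measurable A) &
      forall a A, <<s G>> A ->
        (\int[P]_(t in A) ((a + w t) ^+ 2)%:E = \int[P]_(t in A) (a ^+ 2 + 1)%:E)%E].

Section UnitNoise.
Variables (G : set (set T)) (w : T -> R).
Hypothesis wG : unit_noise G w.

Lemma unit_noise_integral a f : L2_wrt G f ->
  (\int[P]_t ((a + w t) ^+ 2 * f t ^+ 2)%:E =
   \int[P]_t ((a ^+ 2 + 1) * f t ^+ 2)%:E)%E.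
Proof.
case: wG => [[mw _] _ aw] [/meas_wrtP mf [mf' _]].
apply: (@integral_mul_eq <<s G>> (fun t => (a + w t) ^+ 2) (fun=> a ^+ 2 + 1)
         (fun t => f t ^+ 2)) => //.
- by apply: measurable_funX; exact: measurable_funD.
- by move=> t; exact: sqr_ge0.
- by move=> t; rewrite addr_ge0 ?sqr_ge0.
- exact: measurable_funX.
- by move=> t; exact: sqr_ge0.
- by apply/meas_wrtP; exact: measurable_funX.
- by move=> A GA; exact: aw.
Qed.

(** The case a = 0 is an equality of extended reals between the integrals of w^2 f^2 and f^2, so
    finiteness transfers from the second to the first. *)
Lemma unit_noise_sq_integrable f : L2_wrt G f -> sq_integrable P (fun t => w t * f t).
Proof.
move=> fG; have [_ [mf fi]] := fG; have [[mw _] _ _] := wG.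
split; first exact: measurable_funM.
apply/integrableP; split.
  by apply/measurable_EFinP/measurable_funX/measurable_funM.
have := unit_noise_integral 0 fG.
rewrite expr0n /= => E.
under eq_integral do rewrite /= ger0_norm ?sqr_ge0 // exprMn -(add0r (w _)).
rewrite E; have /integrableP[_] := integrableZ_real (0 + 1) fi.
apply: le_lt_trans; rewrite le_eqVlt; apply/orP; left; apply/eqP.
apply: eq_integral => t _ /=.
by rewrite add0r mul1r ger0_norm ?sqr_ge0.
Qed.

Lemma Ex_unit_noise_sqr a f : L2_wrt G f ->
  Ex P (fun t => (a + w t) ^+ 2 * f t ^+ 2) = (a ^+ 2 + 1) * Ex P (fun t => f t ^+ 2).
Proof.
move=> fG; rewrite -ExZ; last by case: fG => _ [].
by rewrite /Ex /Rintegral unit_noise_integral.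
Qed.

Lemma integrable_unit_noise f g : L2_wrt G f -> L2_wrt G g ->
  real_integrable (fun t => w t * (f t * g t)).
Proof.
move=> fG [_ gs]; have := sq_integrable_mul (unit_noise_sq_integrable fG) gs.
by under eq_fun do rewrite -mulrA.
Qed.

Lemma integrable_unit_noise2 f g : L2_wrt G f -> L2_wrt G g ->
  real_integrable (fun t => w t ^+ 2 * (f t * g t)).
Proof.
move=> fG gG.
have := sq_integrable_mul (unit_noise_sq_integrable fG) (unit_noise_sq_integrable gG).
by under eq_fun do rewrite mulrACA -expr2.
Qed.

Lemma Ex_unit_noise2_sqr f : L2_wrt G f ->
  Ex P (fun t => w t ^+ 2 * f t ^+ 2) = Ex P (fun t => f t ^+ 2).
Proof.
move=> fG; have := Ex_unit_noise_sqr 0 fG; rewrite expr0n /= add0r mul1r => <-.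
by congr (Ex P _); apply/funext => t; rewrite add0r.
Qed.

(** The case a = 1: expanding [(1 + w)^2 f^2] and subtracting the known moments of f^2 and w^2 f^2
    leaves only twice the wanted moment. *)
Lemma Ex_unit_noise1_sqr f : L2_wrt G f -> Ex P (fun t => w t * f t ^+ 2) = 0.
Proof.
move=> fG; have fi : real_integrable (fun t => f t ^+ 2) by case: fG => _ [].
have i1 := integrable_unit_noise fG fG; have i2 := integrable_unit_noise2 fG fG.
have := Ex_unit_noise_sqr 1 fG.
have -> : (fun t => (1 + w t) ^+ 2 * f t ^+ 2) =
    (fun t => (f t ^+ 2 + 2 * (w t * (f t * f t))) + w t ^+ 2 * (f t * f t)).
  by apply/funext => t; ring.
rewrite ExD //; last by apply: integrableD_real => //; exact: integrableZ_real.
rewrite ExD //; last exact: integrableZ_real.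
rewrite ExZ //; have := Ex_unit_noise2_sqr fG.
have -> : (fun t => w t ^+ 2 * f t ^+ 2) = (fun t => w t ^+ 2 * (f t * f t)).
  by apply/funext => t; rewrite expr2.
have -> : (fun t => w t * f t ^+ 2) = (fun t => w t * (f t * f t)).
  by apply/funext => t; rewrite [f t ^+ 2]expr2.
by move=> ->; lra.
Qed.

(* Polarization of the two identities for squares. *)
Lemma Ex_unit_noise1 f g : L2_wrt G f -> L2_wrt G g ->
  Ex P (fun t => w t * (f t * g t)) = 0.
Proof.
move=> fG gG; have := Ex_unit_noise1_sqr (L2_wrtD fG gG).
have iff := integrable_unit_noise fG fG; have igg := integrable_unit_noise gG gG.
have ifg := integrable_unit_noise fG gG.
have -> : (fun t => w t * (f t + g t) ^+ 2) =
    (fun t => (w t * (f t * f t) + w t * (g t * g t)) + 2 * (w t * (f t * g t))).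
  by apply/funext => t; ring.
rewrite ExD; [|exact: integrableD_real|exact: integrableZ_real].
rewrite ExD // ExZ //.
have := Ex_unit_noise1_sqr fG; have := Ex_unit_noise1_sqr gG.
by under eq_fun do rewrite expr2; move=> ->; under eq_fun do rewrite expr2; move=> ->; lra.
Qed.

Lemma Ex_unit_noise2 f g : L2_wrt G f -> L2_wrt G g ->
  Ex P (fun t => w t ^+ 2 * (f t * g t)) = Ex P (fun t => f t * g t).
Proof.
move=> fG gG; have := Ex_unit_noise2_sqr (L2_wrtD fG gG).
have iff := integrable_unit_noise2 fG fG; have igg := integrable_unit_noise2 gG gG.
have ifg := integrable_unit_noise2 fG gG.
have [[_ fs] [_ gs]] := (fG, gG).
have jff := sq_integrable_mul fs fs; have jgg := sq_integrable_mul gs gs.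
have jfg := sq_integrable_mul fs gs.
have -> : (fun t => w t ^+ 2 * (f t + g t) ^+ 2) =
    (fun t => (w t ^+ 2 * (f t * f t) + w t ^+ 2 * (g t * g t))
              + 2 * (w t ^+ 2 * (f t * g t))).
  by apply/funext => t; ring.
have -> : (fun t => (f t + g t) ^+ 2) =
    (fun t => (f t * f t + g t * g t) + 2 * (f t * g t)).
  by apply/funext => t; ring.
rewrite !ExD // ?ExZ //; try exact: integrableD_real; try exact: integrableZ_real.
have := Ex_unit_noise2_sqr fG; have := Ex_unit_noise2_sqr gG.
have sqE (p : T -> R) : (fun t => w t ^+ 2 * p t ^+ 2) = (fun t => w t ^+ 2 * (p t * p t)).
  by apply/funext => t; rewrite [p t ^+ 2]expr2.
have sqE' (p : T -> R) : (fun t => p t ^+ 2) = (fun t => p t * p t).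
  by apply/funext => t; rewrite expr2.
by rewrite !sqE !sqE' => -> ->; lra.
Qed.

End UnitNoise.

End ConditionalMoments.

(** * Noise conditioned on the initial state and the past *)

Section Information.
Context {d : measure_display} {T : measurableType d} {R : realType}.
Variable P : probability T R.

(** The sets on which the integrals agree form a Dynkin system. Complements are obtained by
    subtraction, which is legitimate because both functions are integrable. *)
Lemma integral_eq_dynkin (G : set (set T)) (phi1 phi2 : T -> R) :
  G setT -> setI_closed G -> (forall A, G A -> measurable A) ->
  (forall t, 0 <= phi1 t) -> (forall t, 0 <= phi2 t) ->
  real_integrable P phi1 -> real_integrable P phi2 ->
  (forall A, G A ->
    (\int[P]_(t in A) (phi1 t)%:E = \int[P]_(t in A) (phi2 t)%:E)%E) ->
  forall A, <<s G>> A ->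
    (\int[P]_(t in A) (phi1 t)%:E = \int[P]_(t in A) (phi2 t)%:E)%E.
Proof.
move=> GT GI mG p1 p2 i1 i2 eqG.
pose L A := measurable A /\
  (\int[P]_(t in A) (phi1 t)%:E = \int[P]_(t in A) (phi2 t)%:E)%E.
suff LG : <<s G>> `<=` L by move=> A /LG[].
rewrite -(setI_closed_g_dynkin_g_sigma_algebra GI); apply: smallest_sub; last first.
  by move=> A GA; split; [exact: mG | exact: eqG].
split.
- by split; [exact: measurableT | exact: eqG].
- move=> A [mA eqA]; split; first exact: measurableC.
  have E phi : (forall t, 0 <= phi t) -> real_integrable P phi ->
      (\int[P]_(t in ~` A) (phi t)%:E =
       \int[P]_t (phi t)%:E - \int[P]_(t in A) (phi t)%:E)%E.
    move=> p0 ip.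
    have mp : measurable_fun setT (EFin \o phi) by case/integrableP: ip.
    rewrite -(setUv A) ge0_integral_setU //.
    + rewrite addeAC subee ?add0e //.
      apply: integrable_fin_num => //.
      exact: integrableS ip.
    + exact: measurableC.
    + by rewrite setUv.
    + by move=> t _; rewrite lee_fin.
    + by apply/disj_setPCl.
  by rewrite (E _ p1 i1) (E _ p2 i2) eqA (eqG _ GT).
- move=> F tF LF; split; first by apply: bigcup_measurable => k _; case: (LF k).
  have E phi : (forall t, 0 <= phi t) -> real_integrable P phi ->
      (\int[P]_(t in \bigcup_k F k) (phi t)%:E =
       \sum_(i <oo) \int[P]_(t in F i) (phi t)%:E)%E.
    move=> p0 /integrableP[mp _]; rewrite ge0_integral_bigcup //.
    + by move=> k; case: (LF k).
    + exact: measurable_funTS.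
    + by move=> t _; rewrite lee_fin.
  rewrite (E _ p1 i1) (E _ p2 i2); apply: eq_eseriesr => i _.
  by case: (LF i).
Qed.

(** The generating class of [sigma_gen], named so that [sigma_gen fs] is [<<s preimages fs>>] by
    unfolding. *)
Definition preimages (fs : set (T -> R)) : set (set T) :=
  [set A | exists f, fs f /\ exists2 B : set R, measurable B & A = f @^-1` B].

Lemma sigma_gen_sub (fs gs : set (T -> R)) : fs `<=` gs ->
  sigma_gen fs `<=` sigma_gen gs.
Proof.
move=> fg; apply: sub_sigma_algebra2 => A [f [/fg gf fA]].
by exists f.
Qed.

Lemma sigma_gen_measurable (fs : set (T -> R)) :
  (forall f, fs f -> measurable_fun setT f) ->
  forall A, sigma_gen fs A -> measurable A.
Proof.
move=> mf; apply: smallest_sub; first exact: sigma_algebra_measurable.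
by move=> A [f [/mf fm [B mB ->]]]; rewrite -[_ @^-1` _]setTI; exact: fm.
Qed.

Lemma meas_wrt_sigma_gen (fs : set (T -> R)) f : fs f -> meas_wrt (sigma_gen fs) f.
Proof.
by move=> fsf B mB; apply: sub_sigma_algebra; exists f; split=> //; exists B.
Qed.

Lemma meas_wrt_sub (F1 F2 : set (set T)) (f : T -> R) : F1 `<=` F2 ->
  meas_wrt F1 f -> meas_wrt F2 f.
Proof. by move=> F12 mf B mB; apply/F12/mf. Qed.

(** Independence says that the indicator of [A] and the constant [P A] have the same integral over
    each set of [F2]; [integral_mul_eq] then admits the weight [h]. *)
Lemma indep_integral (F1 F2 : set (set T)) (h : T -> R) (A : set T) :
  (forall B, F1 B -> measurable B) -> (forall B, F2 B -> measurable B) ->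
  indep_sigma P F1 F2 -> F1 A ->
  measurable_fun setT h -> (forall t, 0 <= h t) -> meas_wrt F2 h ->
  (\int[P]_(t in A) (h t)%:E = P A * \int[P]_t (h t)%:E)%E.
Proof.
move=> mF1 mF2 ind FA mh h0 hF2; have mA := mF1 _ FA.
have [c c0 PA] : exists2 c, 0 <= c & P A = c%:E.
  by exists (fine (P A)); rewrite ?fine_ge0 // fineK // fin_num_measure.
have := @integral_mul_eq _ _ _ P F2 (\1_A) (fun=> c) h.
rewrite PA => E; rewrite -ge0_integralZl_EFin //; last 2 first.
- by move=> t _; rewrite lee_fin.
- exact/measurable_EFinP.
rewrite [LHS]integral_mkcond; under [RHS]eq_integral do rewrite -EFinM.
rewrite -E //.
- apply: eq_integral => t _; rewrite /patch indicE.
  by case: ifP => _; rewrite ?mul1r ?mul0r.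
- move=> B FB; rewrite integral_cst; last exact: mF2.
  by rewrite integral_indic //; [rewrite -PA; exact: ind | exact: mF2].
Qed.

Lemma unit_noise_intro (G : set (set T)) (w : T -> R) :
  (forall A, <<s G>> A -> measurable A) ->
  real_integrable P w -> real_integrable P (fun t => w t ^+ 2) ->
  (forall A, <<s G>> A -> (\int[P]_(t in A) (w t)%:E = 0)%E) ->
  (forall A, <<s G>> A -> (\int[P]_(t in A) (w t ^+ 2)%:E = P A)%E) ->
  unit_noise P G w.
Proof.
move=> mG iw iw2 w1 w2.
have mw : measurable_fun setT w by case/integrableP : iw => /measurable_EFinP.
split=> // a A GA; have mA := mG A GA.
have iA f : real_integrable P f -> P.-integrable A (EFin \o f).
  by move=> fi; exact: integrableS fi.
have i1 : real_integrable P (fun t => a ^+ 2 + 2 * a * w t).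
  by apply: integrableD_real; [exact: integrable_cst_real | exact: integrableZ_real].
have i2 : real_integrable P (fun=> a ^+ 2) by exact: integrable_cst_real.
have i3 : real_integrable P (fun t => 2 * a * w t) by exact: integrableZ_real.
transitivity (\int[P]_(t in A) ((a ^+ 2)%:E + (2 * a * w t)%:E + (w t ^+ 2)%:E))%E.
  by apply: eq_integral => t _; rewrite -!EFinD; congr EFin; ring.
rewrite (integralD mA (iA _ i1) (iA _ iw2)) (integralD mA (iA _ i2) (iA _ i3)).
under [X in (_ + X + _)%E]eq_integral do rewrite /= EFinM.
rewrite (integralZl mA (iA _ iw)) !integral_cst // w2 // w1 // mule0 adde0.
by rewrite EFinD ge0_muleDl ?mul1e // lee_fin ?sqr_ge0.
Qed.

Lemma unit_noise_sub (G1 G2 : set (set T)) (w : T -> R) : <<s G1>> `<=` <<s G2>> ->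
  unit_noise P G2 w -> unit_noise P G1 w.
Proof.
move=> G12 [ws mG wE]; split=> // [A /G12|a A /G12]; [exact: mG | exact: wE].
Qed.

Section Noise.
Variables (N n : nat) (w : nat -> T -> R).
Hypothesis noise : noise_assumptions P N w.

Lemma noise_measurable k : (k < N)%N -> measurable_fun setT (w k).
Proof. by case/noise => /integrableP[/measurable_EFinP]. Qed.

Lemma unit_noise_past k : (k < N)%N ->
  unit_noise P (preimages [set f | exists j, (j < k)%N /\ f = w j]) (w k).
Proof.
move=> kN; have [iw iw2 w1 w2] := noise kN; apply: unit_noise_intro => //.
apply: sigma_gen_measurable => f [j [jk ->]].
exact/noise_measurable/(ltn_trans jk).
Qed.

Variables (l : nat) (xi : T -> 'cV[R]_n).
Hypothesis xi_adm : adm_init P N w l xi.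

Definition info_gen k := preimages [set f | (exists i, f = fun t => xi t i 0) \/
                     (exists j, (l <= j < k)%N /\ f = w j)].

Lemma xi_measurable i : measurable_fun setT (fun t => xi t i 0).
Proof. by case: xi_adm => /(_ i)[]. Qed.

Let Fxi := sigma_gen [set f | exists i, f = fun t => xi t i 0].
Let Fw k := sigma_gen [set f | exists j, (l <= j < k)%N /\ f = w j].

Let mFxi A : Fxi A -> measurable A.
Proof. by apply: sigma_gen_measurable => f [i ->]; exact: xi_measurable. Qed.

Let mFw k A : (k <= N)%N -> Fw k A -> measurable A.
Proof.
move=> kN; apply: sigma_gen_measurable => f [j [/andP[_ jk] ->]].
exact/noise_measurable/(leq_trans jk).
Qed.

(** A class stable under intersection whose generated sigma-algebra contains the information at time
    [k]. *)
Let Rect k := [set A | exists A1 A2, [/\ Fxi A1, Fw k A2 & A = A1 `&` A2]].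

Let sigT (G : set (set T)) : <<s G>> setT.
Proof. exact: (@measurableT _ (g_sigma_algebraType G)). Qed.

Let sigI (G : set (set T)) A B : <<s G>> A -> <<s G>> B -> <<s G>> (A `&` B).
Proof. exact: (@measurableI _ (g_sigma_algebraType G)). Qed.

Let info_Rect k : <<s info_gen k>> `<=` <<s Rect k>>.
Proof.
apply: smallest_sub; first exact: smallest_sigma_algebra.
move=> A [f [fs [B mB ->]]]; apply: sub_sigma_algebra.
have pre gs : gs f -> sigma_gen gs (f @^-1` B).
  by move=> gf; exact: meas_wrt_sigma_gen.
case: fs => [fx|fw].
  by exists (f @^-1` B), setT; split; [exact: pre | exact: sigT | rewrite setIT].
by exists setT, (f @^-1` B); split; [exact: sigT | exact: pre | rewrite setTI].
Qed.

Lemma unit_noise_info k : (l <= k < N)%N -> unit_noise P (info_gen k) (w k).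
Proof.
move=> /andP[lk kN]; apply: (unit_noise_sub (@info_Rect k)).
have past : unit_noise P (preimages [set f | exists j, (l <= j < k)%N /\ f = w j]) (w k).
  apply: unit_noise_sub (unit_noise_past kN); apply: sigma_gen_sub.
  by move=> f [j [/andP[_ jk] ->]]; exists j.
have [ws _ wE] := past; have mw := noise_measurable kN.
have mRect A : Rect k A -> measurable A.
  by move=> [A1 [A2 [F1 F2 ->]]]; apply: measurableI; [exact: mFxi | exact: mFw (ltnW kN) F2].
split=> //.
  by apply: smallest_sub => //; exact: sigma_algebra_measurable.
move=> a; apply: integral_eq_dynkin => //.
- by exists setT, setT; split; [exact: sigT | exact: sigT | rewrite setIT].
- move=> A B [A1 [A2 [FA1 FA2 ->]]] [B1 [B2 [FB1 FB2 ->]]].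
  exists (A1 `&` B1), (A2 `&` B2); split; [exact: sigI|exact: sigI|exact: setIACA].
- by move=> t; exact: sqr_ge0.
- by move=> t; rewrite addr_ge0 ?sqr_ge0.
- by have [] := sq_integrableD (sq_integrable_cst P a) ws.
- exact: integrable_cst_real.
move=> A [A1 [A2 [F1 F2 ->]]]; have mA1 := mFxi F1; have mA2 := mFw (ltnW kN) F2.
(* The integrand contains [w k], which [Fw k] does not see, so independence is applied with all the
   noise up to the horizon. *)
have FwN : Fw k `<=` Fw N.
  apply: sigma_gen_sub => f [j [/andP[lj jk] ->]]; exists j; split=> //.
  by rewrite lj (ltn_trans jk).
(* The event [A2] is absorbed into the integrand as an indicator, leaving the single event [A1] to
   be separated from a function of the noise. *)
have E (h : T -> R) : measurable_fun setT h -> (forall t, 0 <= h t) ->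
    meas_wrt (Fw N) h ->
    (\int[P]_(t in A1 `&` A2) (h t)%:E = P A1 * \int[P]_(t in A2) (h t)%:E)%E.
  move=> mh h0 hF.
  have mi (G : set (set T)) : <<s G>> A2 ->
      measurable_fun setT (\1_A2 : g_sigma_algebraType G -> R).
    by move=> GA2; exact: measurable_indic.
  have := @indep_integral Fxi (Fw N) (fun t => h t * \1_A2 t) A1 mFxi
     (fun B => @mFw N B (leqnn N)).
  have H D : (\int[P]_(t in D) (h t * \1_A2 t)%:E = \int[P]_(t in D `&` A2) (h t)%:E)%E.
    rewrite integral_mkcondr; apply: eq_integral => t _.
    by rewrite /patch indicE; case: ifP => _; rewrite ?mulr1 ?mulr0.
  rewrite !H setTI; apply => //.
  + by case: xi_adm.
  + by apply: measurable_funM => //; exact: measurable_indic.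
  + by move=> t; rewrite mulr_ge0 // indicE ler0n.
  + apply/meas_wrtP; apply: measurable_funM; first exact/meas_wrtP.
    by apply: mi; exact: FwN.
rewrite !E //.
- by rewrite wE.
- by move=> t; rewrite addr_ge0 ?sqr_ge0.
- by apply/meas_wrtP; exact: measurable_cst.
- by apply: measurable_funX; exact: measurable_funD.
- by move=> t; exact: sqr_ge0.
- apply/meas_wrtP; apply: measurable_funX; apply: measurable_funD => //.
  by apply/meas_wrtP; apply: (@meas_wrt_sigma_gen _ (w k)); exists k; rewrite lk kN.
Qed.

End Noise.

End Information.

(** * Moments of quadratic forms in random vectors *)

Section VectorMoments.
Context {d : measure_display} {T : measurableType d} {R : realType}.
Variable P : probability T R.

Definition deviation p (X : T -> 'cV[R]_p) : T -> 'cV[R]_p := fun t => X t - Evec P X.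

Lemma sq_integrable_sum I (r : seq I) (f : I -> T -> R) :
  (forall i, sq_integrable P (f i)) -> sq_integrable P (fun t => \sum_(i <- r) f i t).
Proof.
move=> fi; elim: r => [|i r IH].
  by under eq_fun do rewrite big_nil; exact: sq_integrable_cst.
by under eq_fun do rewrite big_cons; exact: sq_integrableD.
Qed.

Lemma vec_sq_integrableD p (X Y : T -> 'cV[R]_p) :
  vec_sq_integrable P X -> vec_sq_integrable P Y ->
  vec_sq_integrable P (fun t => X t + Y t).
Proof.
by move=> Xs Ys i; under eq_fun do rewrite mxE; exact: sq_integrableD.
Qed.

Lemma vec_sq_integrableM p q (A : 'M[R]_(p, q)) (X : T -> 'cV[R]_q) :
  vec_sq_integrable P X -> vec_sq_integrable P (fun t => A *m X t).
Proof.
move=> Xs i; under eq_fun do rewrite mxE.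
by apply: sq_integrable_sum => j; exact: sq_integrableZ.
Qed.

Lemma vec_sq_integrable_cst p (c : 'cV[R]_p) : vec_sq_integrable P (fun=> c).
Proof. by move=> i; exact: sq_integrable_cst. Qed.

Lemma vec_sq_integrable_deviation p (X : T -> 'cV[R]_p) :
  vec_sq_integrable P X -> vec_sq_integrable P (deviation X).
Proof.
by move=> Xs; apply: vec_sq_integrableD => //; exact: vec_sq_integrable_cst.
Qed.

Lemma EvecD p (X Y : T -> 'cV[R]_p) :
  vec_sq_integrable P X -> vec_sq_integrable P Y ->
  Evec P (fun t => X t + Y t) = Evec P X + Evec P Y.
Proof.
move=> Xs Ys; apply/colP => i; rewrite !mxE -ExD; try exact: sq_integrable_integrable.
by congr (Ex P _); apply/funext => t; rewrite mxE.
Qed.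

Lemma EvecM p q (A : 'M[R]_(p, q)) (X : T -> 'cV[R]_q) :
  vec_sq_integrable P X -> Evec P (fun t => A *m X t) = A *m Evec P X.
Proof.
move=> Xs; apply/colP => i; rewrite !mxE.
transitivity (\sum_j Ex P (fun t => A i j * X t j 0)); last first.
  by apply: eq_bigr => j _; rewrite mxE ExZ //; exact: sq_integrable_integrable.
rewrite -Ex_sum; last by move=> j; exact/integrableZ_real/sq_integrable_integrable.
by congr (Ex P _); apply/funext => t; rewrite mxE.
Qed.

Lemma Evec_cst p (c : 'cV[R]_p) : Evec P (fun=> c) = c.
Proof. by apply/colP => i; rewrite mxE Ex_cst. Qed.

Lemma Evec_deviation p (X : T -> 'cV[R]_p) : vec_sq_integrable P X -> Evec P (deviation X) = 0.
Proof.
move=> Xs; rewrite (@EvecD _ X (fun=> - Evec P X)) //.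
  by rewrite Evec_cst subrr.
exact: vec_sq_integrable_cst.
Qed.

(** The weight [phi] will be 1, [w] or [w ^+ 2], the three kinds of terms in the expansion of a
    quadratic form at X + w Y. *)
Lemma Ex_weighted_bform p q (M : 'M[R]_(p, q)) (phi : T -> R)
    (X : T -> 'cV[R]_p) (Y : T -> 'cV[R]_q) :
  (forall i j, real_integrable P (fun t => phi t * (X t i 0 * Y t j 0))) ->
  real_integrable P (fun t => phi t * bform M (X t) (Y t)) /\
  Ex P (fun t => phi t * bform M (X t) (Y t)) =
  \sum_i \sum_j M i j * Ex P (fun t => phi t * (X t i 0 * Y t j 0)).
Proof.
move=> XY.
have -> : (fun t => phi t * bform M (X t) (Y t)) =
    (fun t => \sum_i \sum_j M i j * (phi t * (X t i 0 * Y t j 0))).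
  apply/funext => t; rewrite bform_sum mulr_sumr; apply: eq_bigr => i _.
  by rewrite mulr_sumr; apply: eq_bigr => j _; rewrite mulrCA.
split.
  by apply: integrable_sum_real => i; apply: integrable_sum_real => j; exact: integrableZ_real.
rewrite Ex_sum; last first.
  by move=> i; apply: integrable_sum_real => j; exact: integrableZ_real.
apply: eq_bigr => i _; rewrite Ex_sum; last by move=> j; exact: integrableZ_real.
by apply: eq_bigr => j _; rewrite ExZ.
Qed.

Section Bform.
Variables (p q : nat) (M : 'M[R]_(p, q)) (X : T -> 'cV[R]_p) (Y : T -> 'cV[R]_q).
Hypotheses (Xs : vec_sq_integrable P X) (Ys : vec_sq_integrable P Y).

Lemma integrable_bform : real_integrable P (fun t => bform M (X t) (Y t)).
Proof.
have [|+ _] := @Ex_weighted_bform _ _ M (fun=> 1) X Y.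
  by move=> i j; under eq_fun do rewrite mul1r; exact: sq_integrable_mul.
by under eq_fun do rewrite mul1r.
Qed.

Lemma Ex_bform : Ex P (fun t => bform M (X t) (Y t)) =
  \sum_i \sum_j M i j * Ex P (fun t => X t i 0 * Y t j 0).
Proof.
have [|_] := @Ex_weighted_bform _ _ M (fun=> 1) X Y.
  by move=> i j; under eq_fun do rewrite mul1r; exact: sq_integrable_mul.
under eq_fun do rewrite mul1r; move=> ->.
apply: eq_bigr => i _; apply: eq_bigr => j _; congr (_ * Ex P _).
by apply/funext => t; rewrite mul1r.
Qed.

End Bform.

Lemma Ex_bform_cstr p q (M : 'M[R]_(p, q)) X c : vec_sq_integrable P X ->
  Ex P (fun t => bform M (X t) c) = bform M (Evec P X) c.
Proof.
move=> Xs; have cs : vec_sq_integrable P (fun=> c) by exact: vec_sq_integrable_cst.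
rewrite (Ex_bform M Xs cs).
rewrite bform_sum; apply: eq_bigr => i _; apply: eq_bigr => j _.
rewrite mxE [Ex P _ * _]mulrC -(ExZ _ (sq_integrable_integrable (Xs i))).
by congr (_ * Ex P _); apply/funext => t; rewrite mulrC.
Qed.

Lemma Ex_bform_cstl p q (M : 'M[R]_(p, q)) Y c : vec_sq_integrable P Y ->
  Ex P (fun t => bform M c (Y t)) = bform M c (Evec P Y).
Proof.
move=> Ys; rewrite -bform_tr -Ex_bform_cstr //.
by congr (Ex P _); apply/funext => t; rewrite bform_tr.
Qed.

(** The cross terms vanish because deviations have mean zero. *)
Lemma Ex_bform_deviation p q (M : 'M[R]_(p, q)) X Y :
  vec_sq_integrable P X -> vec_sq_integrable P Y ->
  Ex P (fun t => bform M (X t) (Y t)) =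
  Ex P (fun t => bform M (deviation X t) (deviation Y t)) + bform M (Evec P X) (Evec P Y).
Proof.
move=> Xs Ys; have cX := vec_sq_integrable_deviation Xs; have cY := vec_sq_integrable_deviation Ys.
have cst r (c : 'cV[R]_r) := vec_sq_integrable_cst c.
have -> : (fun t => bform M (X t) (Y t)) = (fun t =>
    (bform M (deviation X t) (deviation Y t) + bform M (deviation X t) (Evec P Y))
    + (bform M (Evec P X) (deviation Y t) + bform M (Evec P X) (Evec P Y))).
  by apply/funext => t; rewrite -bformDr -bformDr -bformDl /deviation !subrK.
have i1 := integrable_bform M cX cY.
have i2 := integrable_bform M cX (cst _ (Evec P Y)).
have i3 := integrable_bform M (cst _ (Evec P X)) cY.
have i4 := integrable_cst_real P (bform M (Evec P X) (Evec P Y)).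
rewrite ExD; [|exact: integrableD_real|exact: integrableD_real].
rewrite (ExD i1 i2) (ExD i3 i4) Ex_bform_cstr // Ex_bform_cstl // !Evec_deviation // Ex_cst.
by rewrite /bform trmx0 mulmx0 !mul0mx mxE addr0 add0r.
Qed.

Section Adapted.
Variable G : set (set T).

Definition vL2_wrt p (X : T -> 'cV[R]_p) := forall i, L2_wrt P G (fun t => X t i 0).

Lemma vL2_wrt_sq p (X : T -> 'cV[R]_p) : vL2_wrt X -> vec_sq_integrable P X.
Proof. by move=> XG i; case: (XG i). Qed.

Lemma vL2_wrtD p (X Y : T -> 'cV[R]_p) :
  vL2_wrt X -> vL2_wrt Y -> vL2_wrt (fun t => X t + Y t).
Proof. by move=> XG YG i; under eq_fun do rewrite mxE; exact: L2_wrtD. Qed.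

Lemma vL2_wrt_cst p (c : 'cV[R]_p) : vL2_wrt (fun=> c).
Proof. by move=> i; exact: L2_wrt_cst. Qed.

Lemma vL2_wrtM p q (A : 'M[R]_(p, q)) (X : T -> 'cV[R]_q) :
  vL2_wrt X -> vL2_wrt (fun t => A *m X t).
Proof.
move=> XG i; under eq_fun do rewrite mxE.
elim: (index_enum _) => [|j r IH].
  by under eq_fun do rewrite big_nil; exact: L2_wrt_cst.
by under eq_fun do rewrite big_cons; apply: L2_wrtD => //; exact: L2_wrtZ.
Qed.

Lemma vL2_wrt_deviation p (X : T -> 'cV[R]_p) : vL2_wrt X -> vL2_wrt (deviation X).
Proof. by move=> XG; apply: vL2_wrtD => //; exact: vL2_wrt_cst. Qed.

Variable w : T -> R.
Hypothesis wG : unit_noise P G w.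

Lemma vec_sq_integrable_noise p (Y : T -> 'cV[R]_p) :
  vL2_wrt Y -> vec_sq_integrable P (fun t => w t *: Y t).
Proof.
move=> YG i; under eq_fun do rewrite mxE.
exact (unit_noise_sq_integrable wG (YG i)).
Qed.

Lemma Evec_noise p (Y : T -> 'cV[R]_p) : vL2_wrt Y -> Evec P (fun t => w t *: Y t) = 0.
Proof.
move=> YG; apply/colP => i; rewrite !mxE.
rewrite -(Ex_unit_noise1 wG (YG i) (L2_wrt_cst P G 1)).
by congr (Ex P _); apply/funext => t; rewrite mxE mulr1.
Qed.

Lemma Ex_quad_noise p (M : 'M[R]_p) (X Y : T -> 'cV[R]_p) : vL2_wrt X -> vL2_wrt Y ->
  Ex P (fun t => quad M (X t + w t *: Y t)) =
  Ex P (fun t => quad M (X t)) + Ex P (fun t => quad M (Y t)).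
Proof.
move=> XG YG; have Xs := vL2_wrt_sq XG; have Ys := vL2_wrt_sq YG.
have -> : (fun t => quad M (X t + w t *: Y t)) = (fun t =>
    (bform M (X t) (X t) + (w t * bform M (X t) (Y t) + w t * bform M (Y t) (X t)))
    + w t ^+ 2 * bform M (Y t) (Y t)).
  apply/funext => t; rewrite quadE bformDl !bformDr !bformZl !bformZr; ring.
have iX := integrable_bform M Xs Xs.
have [i1 E1] := @Ex_weighted_bform _ _ M w X Y
  (fun i j => integrable_unit_noise wG (XG i) (YG j)).
have [i2 E2] := @Ex_weighted_bform _ _ M w Y X
  (fun i j => integrable_unit_noise wG (YG i) (XG j)).
have [i3 E3] := @Ex_weighted_bform _ _ M (fun t => w t ^+ 2) Y Y
  (fun i j => integrable_unit_noise2 wG (YG i) (YG j)).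
have i12 := integrableD_real i1 i2.
rewrite (ExD (integrableD_real iX i12) i3) (ExD iX i12) (ExD i1 i2) E1 E2 E3.
rewrite [X in _ + (X + _)]big1; last first.
  move=> i _; rewrite big1 // => j _.
  by rewrite (Ex_unit_noise1 wG (XG i) (YG j)) mulr0.
rewrite [X in _ + (_ + X)]big1; last first.
  move=> i _; rewrite big1 // => j _.
  by rewrite (Ex_unit_noise1 wG (YG i) (XG j)) mulr0.
rewrite !addr0; congr (_ + _); rewrite -[RHS]/(Ex P (fun t => bform M (Y t) (Y t))).
rewrite Ex_bform //; apply: eq_bigr => i _; apply: eq_bigr => j _.
by rewrite (Ex_unit_noise2 wG (YG i) (YG j)).
Qed.

End Adapted.

End VectorMoments.

(** * One-step identity for the value function *)

Section ValueIdentity.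
Context {d : measure_display} {T : measurableType d} {R : realType}.
Variables (P : probability T R) (n m : nat) (D : MFLQdata R n m) (w : nat -> T -> R).

Definition stage_cost k (x : T -> 'cV[R]_n) (u : T -> 'cV[R]_m) : R :=
  Ex P (fun t => quad (cQ D k) (x t) + 2 * bil (cS D k) (u t) (x t) + quad (cR D k) (u t))
  + (quad (cQb D k) (Evec P x) + 2 * bil (cSb D k) (Evec P u) (Evec P x)
     + quad (cRb D k) (Evec P u)).

Definition value (P0 Pi0 : 'M[R]_n) (x : T -> 'cV[R]_n) : R :=
  Ex P (fun t => quad P0 (deviation P x t)) + quad Pi0 (Evec P x).

Definition residual k (P1 Pi1 : 'M[R]_n) (Th Thb : 'M[R]_(m, n))
    (x : T -> 'cV[R]_n) (u : T -> 'cV[R]_m) : R :=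
  Ex P (fun t => quad (Ups D 0 P1 k) (deviation P u t - Th *m deviation P x t))
  + quad (Upsb D 0 P1 Pi1 k) (Evec P u - Thb *m Evec P x).

Lemma integrable_stage (Q : 'M[R]_n) (S : 'M[R]_(n, m)) (Rm : 'M[R]_m) x u :
  vec_sq_integrable P x -> vec_sq_integrable P u ->
  real_integrable P (fun t => quad Q (x t) + 2 * bil S (u t) (x t) + quad Rm (u t)).
Proof.
move=> xs us; under eq_fun do rewrite bilE.
apply: integrableD_real; last exact: (integrable_bform Rm us us).
apply: integrableD_real; first exact: (integrable_bform Q xs xs).
exact/integrableZ_real/integrable_bform.
Qed.

Lemma Ex_stage (Q : 'M[R]_n) (S : 'M[R]_(n, m)) (Rm : 'M[R]_m) x u :
  vec_sq_integrable P x -> vec_sq_integrable P u ->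
  Ex P (fun t => quad Q (x t) + 2 * bil S (u t) (x t) + quad Rm (u t)) =
  Ex P (fun t => bform Q (x t) (x t)) + 2 * Ex P (fun t => bform S (x t) (u t))
  + Ex P (fun t => bform Rm (u t) (u t)).
Proof.
move=> xs us; have i1 := integrable_bform Q xs xs.
have i2 := integrable_bform S xs us; have i3 := integrable_bform Rm us us.
have -> : (fun t => quad Q (x t) + 2 * bil S (u t) (x t) + quad Rm (u t)) =
    (fun t => bform Q (x t) (x t) + 2 * bform S (x t) (u t) + bform Rm (u t) (u t)).
  by apply/funext => t; rewrite bilE.
rewrite (ExD (integrableD_real i1 (integrableZ_real 2 i2)) i3).
by rewrite (ExD i1 (integrableZ_real 2 i2)) (ExZ 2 i2).
Qed.

Lemma Ex_stage_deviation (Q : 'M[R]_n) (S : 'M[R]_(n, m)) (Rm : 'M[R]_m) x u :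
  vec_sq_integrable P x -> vec_sq_integrable P u ->
  Ex P (fun t => quad Q (x t) + 2 * bil S (u t) (x t) + quad Rm (u t)) =
  Ex P (fun t => quad Q (deviation P x t) + 2 * bil S (deviation P u t) (deviation P x t)
                 + quad Rm (deviation P u t))
  + (quad Q (Evec P x) + 2 * bil S (Evec P u) (Evec P x) + quad Rm (Evec P u)).
Proof.
move=> xs us; have cx := vec_sq_integrable_deviation xs; have cu := vec_sq_integrable_deviation us.
rewrite (Ex_stage Q S Rm xs us) (Ex_stage Q S Rm cx cu).
rewrite (Ex_bform_deviation Q xs xs) (Ex_bform_deviation S xs us) (Ex_bform_deviation Rm us us).
rewrite !quadE bilE; ring.
Qed.

Section OneStep.
Variables (G : set (set T)) (k : nat) (x : T -> 'cV[R]_n) (u : T -> 'cV[R]_m).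
Hypotheses (wG : unit_noise P G (w k)) (xG : vL2_wrt P G x) (uG : vL2_wrt P G u).

Let diffusion t : 'cV[R]_n :=
  cC D k *m x t + cCb D k *m Evec P x + cD D k *m u t + cDb D k *m Evec P u.

Let diffusion_vL2 : vL2_wrt P G diffusion.
Proof.
do ![apply: vL2_wrtD]; do ?[exact: vL2_wrtM|exact: vL2_wrt_cst].
Qed.

Let drift t : 'cV[R]_n :=
  cA D k *m x t + cAb D k *m Evec P x + cB D k *m u t + cBb D k *m Evec P u.

Let drift_vL2 : vL2_wrt P G drift.
Proof.
do ![apply: vL2_wrtD]; do ?[exact: vL2_wrtM|exact: vL2_wrt_cst].
Qed.

Let Evec_affine (A A' : 'M[R]_n) (B B' : 'M[R]_(n, m)) :
  Evec P (fun t => A *m x t + A' *m Evec P x + B *m u t + B' *m Evec P u) =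
  (A + A') *m Evec P x + (B + B') *m Evec P u.
Proof.
have xs := vL2_wrt_sq xG; have us := vL2_wrt_sq uG.
have sx := vec_sq_integrableM A xs; have su := vec_sq_integrableM B us.
have cx := vec_sq_integrable_cst P (A' *m Evec P x).
have cu := vec_sq_integrable_cst P (B' *m Evec P u).
have s1 := vec_sq_integrableD sx cx; have s2 := vec_sq_integrableD s1 su.
rewrite (EvecD s2 cu) (EvecD s1 su) (EvecD sx cx) !Evec_cst (EvecM A xs) (EvecM B us).
by rewrite !mulmxDl addrA.
Qed.

Let deviation_affine (A A' : 'M[R]_n) (B B' : 'M[R]_(n, m)) t :
  A *m x t + A' *m Evec P x + B *m u t + B' *m Evec P u
  - ((A + A') *m Evec P x + (B + B') *m Evec P u)
  = A *m deviation P x t + B *m deviation P u t.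
Proof.
rewrite /deviation !mulmxBr !mulmxDl.
move: (A *m x t) (A' *m _) (B *m u t) (B' *m _) (A *m _) (B *m _) => a a' b b' e f.
by apply/colP => i; rewrite !mxE; ring.
Qed.

(** Two sigma-algebras are needed: the product of noise and diffusion is square-integrable because
    the diffusion is [G]-measurable, whereas the next state is measurable only once [w k] is
    observed. *)
Lemma vL2_wrt_step (G' : set (set T)) : <<s G>> `<=` <<s G'>> ->
  meas_wrt <<s G'>> (w k) -> vL2_wrt P G' (step P D w k x u).
Proof.
move=> GG' wG'.
have up p (X : T -> 'cV[R]_p) : vL2_wrt P G X -> vL2_wrt P G' X.
  by move=> XG i; have [mX sX] := XG i; split=> //; exact: meas_wrt_sub mX.
apply: (@vL2_wrtD _ _ _ P G' _ drift (fun t => w k t *: diffusion t)).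
  exact: up drift_vL2.
move=> i; split; last exact: (vec_sq_integrable_noise wG diffusion_vL2 i).
have [/meas_wrtP md _] := up _ _ diffusion_vL2 i.
apply/meas_wrtP; under eq_fun do rewrite mxE.
by apply: measurable_funM => //; exact/meas_wrtP.
Qed.

Lemma Evec_step : Evec P (step P D w k x u) =
  (cA D k + cAb D k) *m Evec P x + (cB D k + cBb D k) *m Evec P u.
Proof.
have dr := vL2_wrt_sq drift_vL2.
have di := vec_sq_integrable_noise wG diffusion_vL2.
by rewrite (EvecD dr di) (Evec_noise wG diffusion_vL2) addr0 Evec_affine.
Qed.

(** The noise term has mean zero, so it belongs entirely to the deviation of the next state,
    including the mean part of its coefficient. This is why [P1], and not [Pi1], weighs the
    diffusion terms in [Upsb] and [Hmb]. *)
Lemma Ex_quad_step (P1 : 'M[R]_n) :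
  Ex P (fun t => quad P1 (deviation P (step P D w k x u) t)) =
  Ex P (fun t => quad P1 (cA D k *m deviation P x t + cB D k *m deviation P u t))
  + (Ex P (fun t => quad P1 (cC D k *m deviation P x t + cD D k *m deviation P u t))
     + quad P1 ((cC D k + cCb D k) *m Evec P x + (cD D k + cDb D k) *m Evec P u)).
Proof.
have cx := vL2_wrt_deviation xG; have cu := vL2_wrt_deviation uG.
have ds := vL2_wrt_sq diffusion_vL2.
have -> : (fun t => quad P1 (deviation P (step P D w k x u) t)) =
    (fun t => quad P1 (cA D k *m deviation P x t + cB D k *m deviation P u t
                       + w k t *: diffusion t)).
  apply/funext => t; congr (quad P1 _).
  by rewrite {1}/deviation Evec_step -(deviation_affine _ (cAb D k) _ (cBb D k)) /step addrAC.
rewrite (Ex_quad_noise wG P1 _ diffusion_vL2); last first.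
  by apply: vL2_wrtD; exact: vL2_wrtM.
congr (_ + _); rewrite -[LHS]/(Ex P (fun t => bform P1 (diffusion t) (diffusion t))).
rewrite (Ex_bform_deviation P1 ds ds) /diffusion Evec_affine; congr (Ex P _ + _).
by apply/funext => t; rewrite {1 2}/deviation Evec_affine deviation_affine.
Qed.

Lemma value_step (P1 Pi1 : 'M[R]_n) (Th Thb : 'M[R]_(m, n)) :
  MFLQ_symmetric D -> P1^T = P1 -> Pi1^T = Pi1 ->
  Ups D 0 P1 k *m Th = - Hm D P1 k ->
  Upsb D 0 P1 Pi1 k *m Thb = - Hmb D P1 Pi1 k ->
  stage_cost k x u + value P1 Pi1 (step P D w k x u) =
  value (cQ D k + (cA D k)^T *m P1 *m cA D k + (cC D k)^T *m P1 *m cC D k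
         + (Hm D P1 k)^T *m Th)
        (cQ D k + cQb D k
         + (cA D k + cAb D k)^T *m Pi1 *m (cA D k + cAb D k)
         + (cC D k + cCb D k)^T *m P1 *m (cC D k + cCb D k)
         + (Hmb D P1 Pi1 k)^T *m Thb) x
  + residual k P1 Pi1 Th Thb x u.
Proof.
move=> symD sP sPi UTh UbThb.
have cx := vec_sq_integrable_deviation (vL2_wrt_sq xG).
have cu := vec_sq_integrable_deviation (vL2_wrt_sq uG).
rewrite /stage_cost /value /residual Ex_quad_step Evec_step.
rewrite (Ex_stage_deviation _ _ _ (vL2_wrt_sq xG) (vL2_wrt_sq uG)).
have lin (A : 'M[R]_n) (B : 'M[R]_(n, m)) :
    vec_sq_integrable P (fun t => A *m deviation P x t + B *m deviation P u t).
  by apply: vec_sq_integrableD; exact: vec_sq_integrableM.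
(* Completion of squares at each outcome, with weight [P1] on both drift and diffusion, then
   integrated. *)
have centered :
    Ex P (fun t => quad P1 (cA D k *m deviation P x t + cB D k *m deviation P u t))
    + Ex P (fun t => quad P1 (cC D k *m deviation P x t + cD D k *m deviation P u t))
    + Ex P (fun t => quad (cQ D k) (deviation P x t)
        + 2 * bil (cS D k) (deviation P u t) (deviation P x t) + quad (cR D k) (deviation P u t))
  = Ex P (fun t => quad (cQ D k + (cA D k)^T *m P1 *m cA D k
        + (cC D k)^T *m P1 *m cC D k + (Hm D P1 k)^T *m Th) (deviation P x t))
    + Ex P (fun t => quad (Ups D 0 P1 k) (deviation P u t - Th *m deviation P x t)).
  have i1 := integrable_bform P1 (lin (cA D k) (cB D k)) (lin (cA D k) (cB D k)).
  have i2 := integrable_bform P1 (lin (cC D k) (cD D k)) (lin (cC D k) (cD D k)).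
  have i3 := integrable_stage (cQ D k) (cS D k) (cR D k) cx cu.
  have res : vec_sq_integrable P (fun t => deviation P u t - Th *m deviation P x t).
    have -> : (fun t => deviation P u t - Th *m deviation P x t) =
              (fun t => deviation P u t + (- Th) *m deviation P x t).
      by apply/funext => t; rewrite mulNmx.
    by apply: vec_sq_integrableD => //; exact: vec_sq_integrableM.
  rewrite -(ExD i1 i2) -(ExD (integrableD_real i1 i2) i3).
  rewrite -(ExD (integrable_bform _ cx cx) (integrable_bform _ res res)).
  congr (Ex P _); apply/funext => t.
  apply: completion_of_squares => //; first exact: Ups_sym.
  by rewrite /Ups raddf0 addr0.
(* The same identity for the deterministic means, with the summed coefficients, weight [Pi1] on the
   drift and [P1] on the diffusion. *)
have mean := @completion_of_squares R n m (cA D k + cAb D k) (cC D k + cCb D k)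
  (cB D k + cBb D k) (cD D k + cDb D k) (cQ D k + cQb D k) P1 Pi1
  (cS D k + cSb D k) (cR D k + cRb D k) (Upsb D 0 P1 Pi1 k) (Hmb D P1 Pi1 k) Thb
  (Evec P x) (Evec P u) sP sPi (Upsb_sym k symD sP sPi).
have {}mean := mean (ltac:(by rewrite /Upsb raddf0 addr0))
  (ltac:(by rewrite /Hmb [(cS D k + cSb D k)^T]linearD /= addrA)) UbThb.
move: mean; rewrite (quadE (cQ D k + _)) (quadE (cR D k + _)) bilE !bformDm -!quadE -!bilE.
move: centered; lra.
Qed.

End OneStep.

End ValueIdentity.

Lemma quad0 (R : realType) p (M : 'M[R]_p) : quad M 0 = 0.
Proof. by rewrite /quad mulmx0 mxE. Qed.

(** * Cost identity and optimality of the limit feedback *)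

Section ClosedLoop.
Context {d : measure_display} {T : measurableType d} {R : realType}.
Variables (P : probability T R) (N n m : nat) (D : MFLQdata R n m) (w : nat -> T -> R).
Hypothesis noise : noise_assumptions P N w.
Variables (l : nat) (xi : T -> 'cV[R]_n).
Hypothesis xi_adm : adm_init P N w l xi.

Lemma info_gen_sub k : <<s info_gen w l xi k>> `<=` <<s info_gen w l xi k.+1>>.
Proof.
apply: sigma_gen_sub => f [fx|[j [/andP[lj jk] fw]]]; first by left.
by right; exists j; rewrite lj (ltn_trans jk).
Qed.

Lemma vL2_wrt_step_info k (x : T -> 'cV[R]_n) (u : T -> 'cV[R]_m) : (l <= k < N)%N ->
  vL2_wrt P (info_gen w l xi k) x -> vL2_wrt P (info_gen w l xi k) u ->
  vL2_wrt P (info_gen w l xi k.+1) (step P D w k x u).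
Proof.
move=> lkN xG uG.
refine (vL2_wrt_step D (unit_noise_info noise xi_adm lkN) xG uG (@info_gen_sub k) _).
apply: meas_wrt_sigma_gen; right; exists k.
by case/andP: lkN => -> _; rewrite leqnn.
Qed.

Lemma vL2_wrt_init : vL2_wrt P (info_gen w l xi l) xi.
Proof.
move=> i; split; last by case: xi_adm.
by apply: meas_wrt_sigma_gen; left; exists i.
Qed.

Lemma vL2_wrt_ctrl (u : nat -> T -> 'cV[R]_m) k : adm_ctrl P N w l xi u ->
  (l <= k < N)%N -> vL2_wrt P (info_gen w l xi k) (u k).
Proof. by move=> uA lkN i; exact: uA. Qed.

Lemma ltn_offset i : (i < N - l)%N -> (l <= l + i < N)%N.
Proof. by rewrite leq_addr ltn_subRL. Qed.

Lemma vL2_wrt_state (u : nat -> T -> 'cV[R]_m) i : adm_ctrl P N w l xi u ->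
  (i <= N - l)%N -> vL2_wrt P (info_gen w l xi (l + i)) (state_ P D w l xi u i).
Proof.
move=> uA; elim: i => [_|i IH iN]; first by rewrite addn0; exact: vL2_wrt_init.
rewrite addnS; apply: vL2_wrt_step_info; [exact: ltn_offset | exact/IH/ltnW |].
exact/(vL2_wrt_ctrl uA)/ltn_offset.
Qed.

(** Admissibility makes every term integrable, so expectation and sum commute. Splitting the
    terminal state turns the terminal cost into a [value]: [cG] weighs deviation and mean, [cGb] the
    mean only. *)
Lemma cost_stage (u : nat -> T -> 'cV[R]_m) : (l <= N)%N -> adm_ctrl P N w l xi u ->
  cost P N D w l xi u =
  \sum_(i < N - l) stage_cost P D (l + i) (state_ P D w l xi u i) (u (l + i)%N)
  + value P (cG D) (cG D + cGb D) (state_ P D w l xi u (N - l)).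
Proof.
move=> lN uA.
have xs i : (i <= N - l)%N -> vec_sq_integrable P (state_ P D w l xi u i).
  by move=> iN; apply: vL2_wrt_sq; exact: vL2_wrt_state.
have us i : (i < N - l)%N -> vec_sq_integrable P (u (l + i)%N).
  by move=> iN; apply: vL2_wrt_sq (vL2_wrt_ctrl uA (ltn_offset iN)).
pose xN := state_ P D w l xi u (N - l).
pose q (i : 'I_(N - l)) t := let x := state_ P D w l xi u i in
  let v := u (l + i)%N in
  quad (cQ D (l + i)) (x t) + 2 * bil (cS D (l + i)) (v t) (x t) + quad (cR D (l + i)) (v t).
pose b (i : 'I_(N - l)) := let x := state_ P D w l xi u i in
  let v := u (l + i)%N in
  quad (cQb D (l + i)) (Evec P x) + 2 * bil (cSb D (l + i)) (Evec P v) (Evec P x)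
  + quad (cRb D (l + i)) (Evec P v).
have iq i : real_integrable P (q i).
  by apply: integrable_stage; [apply: xs; exact: ltnW | exact: us].
have -> : cost P N D w l xi u = Ex P (fun t =>
    (bform (cG D) (xN t) (xN t) + quad (cGb D) (Evec P xN)) + \sum_i (q i t + b i)).
  rewrite /cost /state; congr (Ex P _); apply/funext => t; congr (_ + _).
  rewrite -{1}(add0n l) big_addn big_mkord; apply: eq_bigr => i _.
  by rewrite (addnC i l) addKn /q /b /=; ring.
have iqb i : real_integrable P (fun t => q i t + b i).
  by apply: integrableD_real => //; exact: integrable_cst_real.
have iG := integrable_bform (cG D) (xs _ (leqnn _)) (xs _ (leqnn _)).
have ic := integrable_cst_real P (quad (cGb D) (Evec P xN)).
rewrite (ExD (integrableD_real iG ic) (integrable_sum_real _ iqb)) (ExD iG ic) Ex_cst.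
rewrite (Ex_sum _ iqb) addrC; congr (_ + _).
  apply: eq_bigr => i _; rewrite (ExD (iq i) (integrable_cst_real P (b i))) Ex_cst.
  by [].
rewrite (Ex_bform_deviation (cG D) (xs _ (leqnn _)) (xs _ (leqnn _))) /value -addrA.
by rewrite (quadE (_ + _)) bformDm.
Qed.

Section Optimality.
Variables (PP Pi : nat -> 'M[R]_n) (Th Thb : nat -> 'M[R]_(m, n)).
Hypotheses (symD : MFLQ_symmetric D) (gains : GRE_gains D N PP Pi Th Thb).

Lemma cost_value_residual (u : nat -> T -> 'cV[R]_m) : (l <= N)%N ->
  adm_ctrl P N w l xi u ->
  cost P N D w l xi u = value P (PP l) (Pi l) xi
  + \sum_(i < N - l) residual P D (l + i) (PP (l + i).+1) (Pi (l + i).+1)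
      (Th (l + i)%N) (Thb (l + i)%N) (state_ P D w l xi u i) (u (l + i)%N).
Proof.
move=> lN uA; have [PN PiN rec] := gains.
rewrite cost_stage // -PiN -PN.
(* The horizon is written [l + (N - l)] so that the number of stages can be generalized to any
   [i <= N - l]; the induction then telescopes [value_step]. *)
rewrite (congr1 PP (esym (subnKC lN))) (congr1 Pi (esym (subnKC lN))).
move: {-2}(N - l)%N (leqnn (N - l)); elim=> [_|i IH iN].
  by rewrite !big_ord0 addn0 addr0 add0r.
have lkN := ltn_offset iN; have /andP[_ kN] := lkN.
have [sP sPi] := GRE_gains_sym symD gains kN.
have [U Ub PE PiE _] := rec _ kN.
have xG := vL2_wrt_state uA (ltnW iN); have uG := vL2_wrt_ctrl uA lkN.
have := value_step (unit_noise_info noise xi_adm lkN) xG uG symD sP sPi U Ub.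
rewrite -PE -PiE => vs; rewrite !big_ord_recr /= addnS -[LHS]addrA vs [LHS]addrA.
by rewrite (IH (ltnW iN)) -[LHS]addrA.
Qed.

(** Since Th x + (Thb - Th) Ex = Th (x - Ex) + Thb Ex, this gain on the mean makes both squares of
    the residual vanish. *)
Definition feedback_mean k := Thb k - Th k.
Let ctrl := cl_ctrl P D w Th feedback_mean (fun=> 0) l xi.

(** The cost is evaluated along [state_], whereas the feedback is built from [cl_state_]; the two
    trajectories must be identified. *)
Lemma cl_stateE i : cl_state_ P D w Th feedback_mean (fun=> 0) l xi i =
  state_ P D w l xi ctrl i.
Proof.
elim: i => [//|i IH] /=; rewrite -IH; congr (step _ _ _ _ _ _).
by apply/funext => t; rewrite /ctrl /cl_ctrl addKn.
Qed.

Lemma adm_cl_ctrl : adm_ctrl P N w l xi ctrl.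
Proof.
pose x := cl_state_ P D w Th feedback_mean (fun=> 0) l xi.
have ctrlG k (y : T -> 'cV[R]_n) : vL2_wrt P (info_gen w l xi k) y ->
    vL2_wrt P (info_gen w l xi k)
      (fun t => Th k *m y t + feedback_mean k *m Evec P y + 0).
  move=> yG; apply: vL2_wrtD; last exact: vL2_wrt_cst.
  by apply: vL2_wrtD; [exact: vL2_wrtM | exact: vL2_wrt_cst].
(* [vL2_wrt_state] presupposes an admissible control, so adaptedness is proved here along the
   closed-loop recursion itself. *)
have xG i : (i <= N - l)%N -> vL2_wrt P (info_gen w l xi (l + i)) (x i).
  elim: i => [_|i IH iN]; first by rewrite addn0; exact: vL2_wrt_init.
  rewrite addnS; apply: vL2_wrt_step_info; [exact: ltn_offset | exact/IH/ltnW |].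
  exact/ctrlG/IH/ltnW.
move=> k /andP[lk kN].
have := ctrlG k (x (k - l)%N); rewrite -{1}(subnKC lk).
by apply; apply: xG; rewrite leq_sub2r // ltnW.
Qed.

Lemma residual_ge0 k (P1 Pi1 : 'M[R]_n) (K Kb : 'M[R]_(m, n)) x u :
  mx_geI (Ups D 0 P1 k) 0 -> mx_geI (Upsb D 0 P1 Pi1 k) 0 ->
  0 <= residual P D k P1 Pi1 K Kb x u.
Proof.
move=> U0 Ub0; apply: addr_ge0; last by have := Ub0 (Evec P u - Kb *m Evec P x); rewrite mul0r.
by apply: Ex_ge0 => t; have := U0 (deviation P u t - K *m deviation P x t); rewrite mul0r.
Qed.

Lemma residual_feedback k (P1 Pi1 : 'M[R]_n) (x : T -> 'cV[R]_n) :
  vec_sq_integrable P x ->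
  residual P D k P1 Pi1 (Th k) (Thb k) x
    (fun t => Th k *m x t + feedback_mean k *m Evec P x + 0) = 0.
Proof.
move=> xs; set u := (fun t => _).
have Eu : Evec P u = Thb k *m Evec P x.
  have -> : u = (fun t => Th k *m x t + feedback_mean k *m Evec P x).
    by apply/funext => t; rewrite /u addr0.
  rewrite (EvecD (vec_sq_integrableM (Th k) xs) (vec_sq_integrable_cst P _)).
  by rewrite (EvecM _ xs) Evec_cst -mulmxDl addrC subrK.
rewrite /residual Eu subrr quad0 addr0 -[RHS](Ex_cst P 0).
congr (Ex P _); apply/funext => t; rewrite /deviation Eu /u addr0.
rewrite (_ : _ - _ = 0) ?quad0 // mulmxBr mulmxBl.
move: (Th k *m x t) (Th k *m _) (Thb k *m _) => a b c.
by apply/colP => i; rewrite !mxE; ring.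
Qed.

Lemma cl_optimal_gains u : (l <= N)%N -> adm_ctrl P N w l xi u ->
  cost P N D w l xi ctrl <= cost P N D w l xi u.
Proof.
move=> lN uA; rewrite (cost_value_residual lN adm_cl_ctrl) (cost_value_residual lN uA).
rewrite lerD2l big1 => [|i _].
  apply: sumr_ge0 => i _; have [_ _ rec] := gains.
  by have /andP[_ /rec[_ _ _ _ [U0 Ub0]]] := ltn_offset (ltn_ord i); exact: residual_ge0.
rewrite -(residual_feedback (l + i) (PP (l + i).+1) (Pi (l + i).+1)
            (vL2_wrt_sq (vL2_wrt_state adm_cl_ctrl (ltnW (ltn_ord i))))).
congr (residual _ _ _ _ _ _ _ _ _).
by apply/funext => t; rewrite {1}/ctrl /cl_ctrl addKn cl_stateE.
Qed.

End Optimality.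

End ClosedLoop.

Unset Implicit Arguments.

Theorem theorem6p4
  (d : measure_display) (T : measurableType d) (R : realType)
  (P : probability T R) (N n m : nat)
  (D : MFLQdata R n m) (w : nat -> T -> R)
  (Peps Pieps : R -> nat -> 'M[R]_n) :
  (0 < N)%N -> (0 < n)%N -> (0 < m)%N ->
  MFLQ_symmetric D ->
  noise_assumptions P N w ->
  cost00_convex P N D w ->
  (forall eps : R, 0 < eps ->
     epsGRE_strongly_regular_solution D N eps (Peps eps) (Pieps eps)) ->
  (exists M : R, forall eps : R, 0 < eps ->
     \sum_(0 <= k < N) (frob2 (Theta_eps D eps (Peps eps) k)
                        + frob2 (Thetab_eps D eps (Peps eps) (Pieps eps) k)) <= M) ->
  GRE_regularly_solvable D N /\ closed_loop_solvable P N D w.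
Proof.
move=> _ _ _ symD noise _ sol bnd.
have [PP [Pi [Th [Thb gains]]]] := epsGRE_limit sol bnd.
split; first by exists PP, Pi; exact: GRE_gains_regular gains.
(* The gains come from the Riccati limit alone, so they depend neither on [l] nor on [xi]; the
   offset [v] is zero. *)
move=> l lN; exists Th, (feedback_mean Th Thb), (fun=> 0) => xi xi_adm u uA.
exact: (cl_optimal_gains noise xi_adm symD gains (ltnW lN) uA).
Qed.
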